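(* For every integer $d\ge 2$ there are positive constants $C_1,C_2,c$ (not depending on $k$ and $n$) such that for every integer $k\ge 2$, every $d$-dimensional $k$-permutation matrix $P$ and every $n\in\mathbb{N}$, \[ n^{-C_1 k}\left(c\, k^{1/(2^{d-1}(d-1))}\right)^n (n!)^{d-1-1/(d-1)} \le |S_P(n)| \le \left(2^{C_2 k}\right)^n (n!)^{d-1-1/(d-1)}. \]
   Context: A $d$-dimensional binary matrix of size $n_1\times\cdots\times n_d$ is an element of $\{0,1\}^{[n_1]\times\cdots\times[n_d]}$. A $d$-dimensional binary matrix of size $k\times\cdots\times k$ is a $d$-dimensional $k$-permutation matrix if it has exactly $k$ $1$-entries and the positions of any two distinct $1$-entries differ in every coordinate. A $d$-dimensional binary matrix $P$ of size $k_1\times\cdots\times k_d$ is contained in a $d$-dimensional binary matrix $A$ of size $n_1\times\cdots\times n_d$ if there are increasing injections $f_i:[k_i]\to[n_i]$, $i=1,\dots,d$, such that $p_{i_1,\dots,i_d}=1$ implies $a_{f_1(i_1),\dots,f_d(i_d)}=1$; otherwise $A$ avoids $P$. $S_P(n)$ denotes the set of $d$-dimensional $n$-permutation matrices avoiding $P$.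
   Formalization: The lower bound is stated only for n ≥ 2: at n = 1 one has |S_P(1)| = 1, so the printed bound would give c·k^{1/(2^{d-1}(d-1))} ≤ 1 for all k, which is false, and at n = 0 the factor n^{-C_1 k} is undefined; the upper bound is for all n. *)

(* Defs.v *)
From mathcomp Require Import all_boot.

Set Implicit Arguments.
Unset Strict Implicit.
Unset Printing Implicit Defensive.

(* Positions and coordinates are numbered from 0, so [n] is rendered as 'I_n. *)
Definition position (d : nat) (n : 'I_d -> nat) : finType :=
  {dffun forall i : 'I_d, 'I_(n i)}.

Definition binmx (d : nat) (n : 'I_d -> nat) : finType :=
  {ffun position n -> bool}.

Definition cube (d n : nat) (i : 'I_d) : nat := n.
Arguments cube : clear implicits.

Definition permutation_matrix (d k : nat) (P : binmx (cube d k)) : bool :=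
  (#|[set x : position (cube d k) | P x]| == k) &&
  [forall x : position (cube d k), forall y : position (cube d k),
     [&& P x, P y & x != y] ==> [forall i : 'I_d, x i != y i]].

Definition index_maps (d : nat) (k n : 'I_d -> nat) : finType :=
  {dffun forall i : 'I_d, {ffun 'I_(k i) -> 'I_(n i)}}.

Definition increasing_maps (d : nat) (k n : 'I_d -> nat)
    (f : index_maps k n) : bool :=
  [forall i : 'I_d, forall a : 'I_(k i), forall b : 'I_(k i),
     (a < b) ==> (f i a < f i b)].

Definition map_position (d : nat) (k n : 'I_d -> nat)
    (f : index_maps k n) (x : position k) : position n :=
  [ffun i : 'I_d => f i (x i)].

Definition contained (d : nat) (k n : 'I_d -> nat)
    (P : binmx k) (A : binmx n) : bool :=
  [exists f : index_maps k n,
     increasing_maps f && [forall x : position k, P x ==> A (map_position f x)]].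

Definition avoids (d : nat) (k n : 'I_d -> nat)
    (A : binmx n) (P : binmx k) : bool := ~~ contained P A.

Definition avoiders (d k : nat) (P : binmx (cube d k)) (n : nat) :
    {set binmx (cube d n)} :=
  [set A : binmx (cube d n) | permutation_matrix A && avoids A P].

(* Main.v *)
(* Avoiding [P] implies avoiding the all-ones [k x ... x k] interval minor, a property
   that survives contracting coordinates into consecutive blocks.

   Upper bound.  By induction on the dimension, a set of cells of [m]^d without this
   minor has at most 2^(O(k)) m^(d-1) elements: contract into blocks of side
   t = 2^(2k+1); blocks in which every coordinate takes fewer than 2^k values are
   handled by recursion on m, and the other ones are counted by Fox's halving argument
   together with the (d-1)-dimensional bound.  Iterating the contraction, there are at
   most 2^n such sets as soon as 2^(O(k)) m^(d-1) <= n.  Taking m as large as this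
   allows, an avoider of size n is determined by its set of nonempty m-cells and, for
   each first coordinate, the choice of a point in these cells; by AM-GM this leaves at
   most (n/m + 1)^(dn) possibilities, which is (n!)^(d-1-1/(d-1)) up to 2^(O(kn)).

   Lower bound.  By Erdos-Szekeres, [P] contains l+1 entries on which all coordinates are
   monotone, with k <= (l+1)^(2^(d-1)).  Take n cells forming l antichains, the grid
   having side O((n/l)^(1/(d-1))); every way of putting one point in each cell avoids
   these l+1 entries, and there are at least (n! / O(m)^n)^d ways.  When n < k the
   factor n^(-C1 k) makes the bound trivial. *)
Require Import Defs.
From HB Require Import structures.
From mathcomp Require Import all_boot all_order all_algebra all_fingroup.
From mathcomp Require Import zify ring lra.
Set Implicit Arguments.
Unset Strict Implicit.
Unset Printing Implicit Defensive.

(** * Interval minors and the upper bound *)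

Lemma leq_card_fibers (T T' : finType) (f : T -> T') (X : {set T})
    (Y : {set T'}) c :
    (forall x, x \in X -> f x \in Y) ->
    (forall y, y \in Y -> #|[set x in X | f x == y]| <= c) ->
  #|X| <= #|Y| * c.
Proof.
move=> fXY fib; rewrite -sum1_card (partition_big f (mem Y)) //= -sum_nat_const.
apply: leq_sum => y yY; apply: leq_trans (fib y yY).
by rewrite sum1dep_card; apply: subset_leq_card; apply/subsetP=> x; rewrite !inE.
Qed.

(* [x] gives the coordinates of the elements of [A]; the monotone maps [g i] cut each axis
   into consecutive intervals, and [K] is the size of an all-ones matrix. *)
Definition interval_minor (d : nat) (T : finType) (x : T -> 'I_d -> nat)
    (K : 'I_d -> nat) (A : {set T}) : Prop :=
  exists2 g : 'I_d -> nat -> nat, (forall i, {homo g i : a b / a <= b}) &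
    forall v : 'I_d -> nat, (forall i, v i < K i) ->
      exists2 p, p \in A & forall i, g i (x p i) = v i.

Lemma minor_sub d (T : finType) (x : T -> 'I_d -> nat) K (A B : {set T}) :
  A \subset B -> interval_minor x K A -> interval_minor x K B.
Proof.
move=> /subsetP AB [g gm gA]; exists g => // v vK.
by have [p /AB pB gp] := gA v vK; exists p.
Qed.

Lemma minor_eq d (T : finType) (x : T -> 'I_d -> nat) K K' (A : {set T}) :
  K =1 K' -> interval_minor x K A -> interval_minor x K' A.
Proof.
move=> eK [g gm gA]; exists g => // v vK; apply: gA => i; rewrite eK; exact: vK.
Qed.

(** Composing the interval maps with monotone coordinate maps pulls a minor back. This serves
    contraction into blocks, projection along an axis, and the passage from a matrix to its
    cells. *)
Lemma minor_image d (T T' : finType) (x : T -> 'I_d -> nat)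
    (x' : T' -> 'I_d -> nat) K (f : T -> T') (h : 'I_d -> nat -> nat)
    (A : {set T}) :
    (forall i, {homo h i : a b / a <= b}) ->
    (forall p i, p \in A -> x' (f p) i = h i (x p i)) ->
  interval_minor x' K (f @: A) -> interval_minor x K A.
Proof.
move=> hm fh [g gm gA]; exists (fun i => g i \o h i) => [i a b ab|v vK].
  exact/gm/hm.
by have [_ /imsetP[p pA ->] gp] := gA v vK; exists p => // i; rewrite /= -fh ?gp.
Qed.

(** * Fox's halving recursion along one coordinate *)

Definition pt_coord {d N} (p : {ffun 'I_d -> 'I_N.+1}) (i : 'I_d) : nat := p i.

Section Points.

Variables d N : nat.

Local Notation pt := {ffun 'I_d -> 'I_N.+1}.

(** Projection inside the same type; the fibres of this map are the rows along [i0]. *)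
Definition zero_at (i0 : 'I_d) (p : pt) : pt :=
  [ffun i => if i == i0 then ord0 else p i].

Definition upd (K : 'I_d -> nat) (i0 : 'I_d) (l : nat) (i : 'I_d) : nat :=
  if i == i0 then l else K i.

Lemma zero_at_eq i0 (p q : pt) : zero_at i0 p = zero_at i0 q ->
  forall i, i != i0 -> p i = q i.
Proof. by move=> /ffunP e i ii0; have := e i; rewrite !ffunE (negPf ii0). Qed.

Lemma card_row i0 (A : {set pt}) z lo t :
    (forall p, p \in A -> lo <= p i0 < lo + t) ->
  #|[set q in A | zero_at i0 q == z]| <= t.
Proof.
move=> Alo; rewrite cardE -(size_map (fun q : pt => q i0 : nat)) -(size_iota lo t).
apply: uniq_leq_size => [|_ /mapP[q + ->]].
  rewrite map_inj_in_uniq ?enum_uniq // => p q.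
  rewrite !mem_enum !inE => /andP[_ /eqP pz] /andP[_ /eqP qz] epq.
  apply/ffunP=> i; case: (eqVneq i i0) => [->|]; first exact: val_inj.
  by apply: zero_at_eq; rewrite pz qz.
by rewrite mem_enum !inE mem_iota => /andP[/Alo].
Qed.

(* All of [A] beyond [h] is merged into one further layer. *)
Lemma minor_extend_right K i0 l h (A A' : {set pt}) :
    (forall p, p \in A' -> p i0 < h) -> A' \subset A ->
    (forall p, p \in A' -> exists2 q, q \in A &
       zero_at i0 q = zero_at i0 p /\ h <= q i0) ->
  interval_minor pt_coord (upd K i0 l.+1) A' -> interval_minor pt_coord (upd K i0 l.+2) A.
Proof.
move=> lth sub ext [g gm gA].
(* [g] may exceed [l] below [h]; capping it there keeps the map monotone with the merged layer
   last. *)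
exists (fun i x => if i == i0 then if x < h then minn (g i x) l else l.+1
                   else g i x) => [i a b ab|v vK] /=.
  case: eqP => _; last exact: gm.
  have := gm i a b ab; case: (ltnP a h); case: (ltnP b h); lia.
have [vl|vl] := ltnP (v i0) l.+1.
  have [i|p pA gp] := gA v.
    by have := vK i; rewrite /upd; case: eqP => // ->.
  exists p; first exact: (subsetP sub).
  move=> i; case: eqP => // ->; rewrite {1}/pt_coord lth // gp; lia.
have [i|p pA gp] := gA (fun i => if i == i0 then 0 else v i).
  by have := vK i; rewrite /upd; case: eqP.
have [q qA [/zero_at_eq qp hq]] := ext p pA.
exists q => // i; case: eqVneq => [->|ii0].
  rewrite {1}/pt_coord ltnNge hq /=; have := vK i0; rewrite /upd eqxx; lia.
by have := gp i; rewrite (negPf ii0) /pt_coord qp.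
Qed.

(** The mirror image: the merged layer comes first, so the old layers move up by one and need no
    cap. *)
Lemma minor_extend_left K i0 l h (A A' : {set pt}) :
    (forall p, p \in A' -> h <= p i0) -> A' \subset A ->
    (forall p, p \in A' -> exists2 q, q \in A &
       zero_at i0 q = zero_at i0 p /\ q i0 < h) ->
  interval_minor pt_coord (upd K i0 l.+1) A' -> interval_minor pt_coord (upd K i0 l.+2) A.
Proof.
move=> lth sub ext [g gm gA].
exists (fun i x => if i == i0 then if x < h then 0 else (g i x).+1
                   else g i x) => [i a b ab|v vK] /=.
  case: eqP => _; last exact: gm.
  have := gm i a b ab; case: (ltnP a h); case: (ltnP b h); lia.
have [vl|vl] := posnP (v i0); last first.
  have [i|p pA gp] := gA (fun i => if i == i0 then (v i0).-1 else v i).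
    by have := vK i; rewrite /upd; case: eqP => // ->; lia.
  exists p; first exact: (subsetP sub).
  move=> i; have := gp i; case: eqP => // -> e.
  rewrite {1}/pt_coord ltnNge lth //= e; lia.
have [i|p pA gp] := gA (fun i => if i == i0 then 0 else v i).
  by have := vK i; rewrite /upd; case: eqP.
have [q qA [/zero_at_eq qp hq]] := ext p pA.
exists q => // i; case: eqVneq => [->|ii0]; first by rewrite {1}/pt_coord hq vl.
by have := gp i; rewrite (negPf ii0) /pt_coord qp.
Qed.

(* Fox's recursion: halving the range of coordinate [i0], a row lies in one half, where
   the same bound applies, or meets both and has at least half of its points in one of
   them; the other half then provides one layer of the minor for free. *)
Lemma row_bound K i0 (X : {set pt}) E :
    (forall B : {set pt}, B \subset X -> ~ interval_minor pt_coord (upd K i0 1) B ->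
       #|zero_at i0 @: B| <= E) ->
  forall tau l sigma lo (A : {set pt}), l <= sigma -> A \subset X ->
    (forall p, p \in A -> lo <= p i0 < lo + 2 ^ tau) ->
    (forall p, p \in A ->
       2 ^ sigma <= #|[set q in A | zero_at i0 q == zero_at i0 p]|) ->
    ~ interval_minor pt_coord (upd K i0 l.+1) A ->
  #|zero_at i0 @: A| * 2 ^ sigma <= E * 2 ^ l * 4 ^ tau.
Proof.
move=> HE tau; elim: tau => [|tau IH] l sigma lo A lsig AX Alo Arow Amin.
all: have [->|/set0Pn[p0 p0A]] := eqVneq A set0; first by rewrite imset0 cards0.
all: have tsig := leq_trans (Arow _ p0A) (card_row _ Alo).
  have sig0 : sigma = 0 by move: tsig; rewrite leq_exp2l //; lia.
  have l0 : l = 0 by lia.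
  by rewrite sig0 l0 !muln1; apply: HE => //; rewrite -l0.
case: l lsig Amin => [|l] lsig Amin.
  rewrite muln1; apply: leq_mul; first exact: HE.
  apply: leq_trans tsig _; rewrite -[4]/(2 ^ 2) -expnM leq_exp2l //; lia.
case: sigma lsig Arow {tsig} => // sigma lsig Arow.
pose h := lo + 2 ^ tau.
pose row p := [set q in A | zero_at i0 q == zero_at i0 p].
(* [A1] and [A2] collect the rows lying in one half. A row meeting both halves has at least
   [2 ^ sigma] points in one of them, and these go to [A3] (lower half) or [A4] (upper half). *)
pose A1 := [set p in A | [forall q in row p, q i0 < h]].
pose A2 := [set p in A | [forall q in row p, h <= q i0]].
pose A3 := [set p in A | [&& p i0 < h, [exists q in row p, h <= q i0] &
                             2 ^ sigma <= #|[set q in row p | q i0 < h]|]].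
pose A4 := [set p in A | [&& h <= p i0, [exists q in row p, q i0 < h] &
                             2 ^ sigma <= #|[set q in row p | h <= q i0]|]].
have sub1 : A1 \subset A by apply/subsetP=> p; rewrite inE => /andP[].
have sub2 : A2 \subset A by apply/subsetP=> p; rewrite inE => /andP[].
have sub3 : A3 \subset A by apply/subsetP=> p; rewrite inE => /andP[].
have sub4 : A4 \subset A by apply/subsetP=> p; rewrite inE => /andP[].
have rowE p q : zero_at i0 q = zero_at i0 p -> row q = row p.
  by move=> e; apply/setP=> r; rewrite !inE e.
have rowself p : p \in A -> p \in row p by move=> pA; rewrite inE pA eqxx.
have expS : 2 ^ tau.+1 = 2 ^ tau + 2 ^ tau by rewrite expnS; lia.
have cov : zero_at i0 @: A \subset (zero_at i0 @: A1 :|: zero_at i0 @: A2)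
              :|: (zero_at i0 @: A3 :|: zero_at i0 @: A4).
  apply/subsetP=> _ /imsetP[p pA ->]; rewrite !inE.
  case e1 : [forall q in row p, q i0 < h].
    have : p \in A1 by rewrite inE pA e1.
    by move=> /(imset_f (zero_at i0)) ->.
  case e2 : [forall q in row p, h <= q i0].
    have : p \in A2 by rewrite inE pA e2.
    by move=> /(imset_f (zero_at i0)) ->; rewrite orbT.
  have [q1 q1r q1h] : exists2 q, q \in row p & h <= q i0.
    move/negbT: e1; rewrite negb_forall => /existsP[q].
    by rewrite negb_imply -leqNgt => /andP[? ?]; exists q.
  have [q2 q2r q2h] : exists2 q, q \in row p & q i0 < h.
    move/negbT: e2; rewrite negb_forall => /existsP[q].
    by rewrite negb_imply -ltnNge => /andP[? ?]; exists q.
  have [q1A q1p] : q1 \in A /\ zero_at i0 q1 = zero_at i0 p.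
    by move: q1r; rewrite inE => /andP[? /eqP].
  have [q2A q2p] : q2 \in A /\ zero_at i0 q2 = zero_at i0 p.
    by move: q2r; rewrite inE => /andP[? /eqP].
  have : 2 ^ sigma.+1 <= #|[set q in row p | q i0 < h]| +
                         #|[set q in row p | h <= q i0]|.
    apply: leq_trans (Arow p pA) _; rewrite -/(row p).
    apply: leq_trans (leq_card_setU _ _); apply: subset_leq_card.
    by apply/subsetP=> q qr; rewrite !inE in qr *; rewrite qr /=; case: ltnP.
  have [L|L] := leqP (2 ^ sigma) #|[set q in row p | q i0 < h]| => R.
    have : q2 \in A3.
      rewrite inE q2A q2h (rowE _ _ q2p) L andbT /=; apply/existsP; exists q1.
      by rewrite q1r.
    by move=> /(imset_f (zero_at i0)); rewrite q2p => ->; rewrite !orbT.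
  have : q1 \in A4.
    rewrite inE q1A q1h (rowE _ _ q1p) /=; apply/andP; split.
      by apply/existsP; exists q2; rewrite q2r.
    move: R L; rewrite expnS; move: #|[set q in row p | q i0 < h]| (2 ^ sigma).
    by move: #|[set q in row p | h <= q i0]| => a b c; clear; lia.
  by move=> /(imset_f (zero_at i0)); rewrite q1p => ->; rewrite !orbT.
have c1 : #|zero_at i0 @: A1| * 2 ^ sigma.+1 <= E * 2 ^ l.+1 * 4 ^ tau.
  apply: (IH l.+1 sigma.+1 lo) => //; first exact: subset_trans AX.
  - move=> p; rewrite inE => /andP[pA /forall_inP /(_ p (rowself p pA)) ph].
    by have := Alo p pA; clear -ph; lia.
  - move=> p pA1; have pA := subsetP sub1 _ pA1.
    apply: leq_trans (Arow p pA) _; apply: subset_leq_card; apply/subsetP=> q.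
    rewrite 2!inE => /andP[qA /eqP e]; rewrite !inE e eqxx andbT qA /=.
    by rewrite (rowE _ _ e); move: pA1; rewrite inE => /andP[].
  - by move=> /(minor_sub sub1).
have c2 : #|zero_at i0 @: A2| * 2 ^ sigma.+1 <= E * 2 ^ l.+1 * 4 ^ tau.
  apply: (IH l.+1 sigma.+1 h) => //; first exact: subset_trans AX.
  - move=> p; rewrite inE => /andP[pA /forall_inP /(_ p (rowself p pA)) ph].
    by have := Alo p pA; clear -ph expS; lia.
  - move=> p pA1; have pA := subsetP sub2 _ pA1.
    apply: leq_trans (Arow p pA) _; apply: subset_leq_card; apply/subsetP=> q.
    rewrite 2!inE => /andP[qA /eqP e]; rewrite !inE e eqxx andbT qA /=.
    by rewrite (rowE _ _ e); move: pA1; rewrite inE => /andP[].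
  - by move=> /(minor_sub sub2).
have c3 : #|zero_at i0 @: A3| * 2 ^ sigma <= E * 2 ^ l * 4 ^ tau.
  apply: (IH l sigma lo) => //; first exact: subset_trans AX.
  - move=> p; rewrite inE => /andP[pA /and3P[ph _ _]].
    by have := Alo p pA; clear -ph; lia.
  - move=> p; rewrite inE => /andP[pA /and3P[ph ex le]].
    apply: leq_trans (le) _; apply: subset_leq_card; apply/subsetP=> q.
    rewrite !inE => /andP[/andP[qA /eqP e] qh].
    by rewrite e eqxx andbT qA qh (rowE _ _ e) ex le.
  - apply: contra_not Amin; apply: (minor_extend_right (h := h)) => //.
      by move=> p; rewrite inE => /andP[_ /andP[]].
    move=> p; rewrite inE => /andP[_ /and3P[_ /existsP[q /andP[]]]].
    by rewrite inE => /andP[qA /eqP ?] ?; exists q.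
have c4 : #|zero_at i0 @: A4| * 2 ^ sigma <= E * 2 ^ l * 4 ^ tau.
  apply: (IH l sigma h) => //; first exact: subset_trans AX.
  - move=> p; rewrite inE => /andP[pA /and3P[ph _ _]].
    by have := Alo p pA; clear -ph expS; lia.
  - move=> p; rewrite inE => /andP[pA /and3P[ph ex le]].
    apply: leq_trans (le) _; apply: subset_leq_card; apply/subsetP=> q.
    rewrite !inE => /andP[/andP[qA /eqP e] qh].
    by rewrite e eqxx andbT qA qh (rowE _ _ e) ex le.
  - apply: contra_not Amin; apply: (minor_extend_left (h := h)) => //.
      by move=> p; rewrite inE => /andP[_ /andP[]].
    move=> p; rewrite inE => /andP[_ /and3P[_ /existsP[q /andP[]]]].
    by rewrite inE => /andP[qA /eqP ?] ?; exists q.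
have cA : #|zero_at i0 @: A| <= #|zero_at i0 @: A1| + #|zero_at i0 @: A2| +
                               (#|zero_at i0 @: A3| + #|zero_at i0 @: A4|).
  apply: leq_trans (subset_leq_card cov) (leq_trans (leq_card_setU _ _) _).
  exact: leq_add (leq_card_setU _ _) (leq_card_setU _ _).
(* With [Z = E * 2 ^ l * 4 ^ tau], each of the four parts contributes at most [2 * Z], and the
   target is exactly [8 * Z]. *)
apply: leq_trans (leq_mul cA (leqnn _)) _.
move: c1 c2 c3 c4; rewrite [4 ^ _.+1]expnS [2 ^ l.+1]expnS [2 ^ sigma.+1]expnS.
set Z := E * 2 ^ l * 4 ^ tau.
have -> : E * (2 * 2 ^ l) * 4 ^ tau = 2 * Z by rewrite /Z mulnCA !mulnA.
have -> : E * (2 * 2 ^ l) * (4 * 4 ^ tau) = 8 * Z.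
  by rewrite /Z mulnCA (mulnCA E) !mulnA.
move: (2 ^ sigma) => s; rewrite !mulnDl ![_ * (2 * s)]mulnCA; clearbody Z; clear; lia.
Qed.

End Points.

(** * Size of a point set without the all-ones minor *)

Lemma leq_card_bigcup (I T : finType) (S : {set I}) (F : I -> {set T}) :
  #|\bigcup_(i in S) F i| <= \sum_(i in S) #|F i|.
Proof.
elim/big_rec2: _ => [|i m B _ le]; first by rewrite cards0.
by apply: leq_trans (leq_card_setU _ _) _; rewrite leq_add2l.
Qed.

Lemma leq_card_block d (T : finType) (x : T -> 'I_d -> nat) t b (A : {set T}) :
    (forall p q, x p =1 x q -> p = q) -> 0 < t ->
    (forall p, p \in A -> forall i, x p i %/ t = b i) ->
  #|A| <= t ^ d.
Proof.
move=> xinj t0 Ab.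
pose f p := [ffun i => Ordinal (ltn_pmod (x p i) t0)].
have finj : {in A &, injective f}.
  move=> p q pA qA /ffunP e; apply: xinj => i.
  have := e i; rewrite !ffunE => /(congr1 val) /= em.
  by rewrite (divn_eq (x p i) t) (divn_eq (x q i) t) em !Ab.
rewrite -(card_in_imset finj); apply: leq_trans (max_card _) _.
by rewrite card_ffun !card_ord.
Qed.

Section Extremal.

Variables d N k : nat.
Hypothesis k_gt0 : 0 < k.

Local Notation pt := {ffun 'I_d -> 'I_N.+1}.

Definition contract (t : nat) (p : pt) : pt := [ffun i => inord (p i %/ t)].

Lemma contractE t p i : contract t p i = p i %/ t :> nat.
Proof.
by rewrite ffunE inordK // ltnS; apply: leq_trans (leq_div _ _) _; rewrite -ltnS.
Qed.

(** [S] holds the active coordinates, so [#|S|] is the dimension while all sets stay in one type. *)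
Definition within_box (S : {set 'I_d}) (n : nat) (A : {set pt}) : Prop :=
  forall p, p \in A -> forall i, p i < n /\ (i \notin S -> p i = 0 :> nat).

Definition dims (S : {set 'I_d}) (i : 'I_d) : nat := if i \in S then k else 1.

(** Large enough that a narrow block in dimension [e + 2], with at most [2 ^ (k * (e + 2))] points,
    still has at most [width ^ (e + 1)] points after doubling; this closes the recursion on the
    scale. *)
Definition width : nat := 2 ^ (2 * k).+1.

Lemma width_gt0 : 0 < width. Proof. by rewrite expn_gt0. Qed.

Lemma minor_contract K t (A : {set pt}) :
  interval_minor pt_coord K (contract t @: A) -> interval_minor pt_coord K A.
Proof.
apply: (minor_image (h := fun _ x => x %/ t)) => [i a b|p i _].
  exact: leq_div2r.
exact: contractE.
Qed.

Lemma within_contract S j (A : {set pt}) :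
  within_box S (width ^ j.+1) A -> within_box S (width ^ j) (contract width @: A).
Proof.
move=> wA _ /imsetP[p /wA pA ->] i; rewrite contractE ltn_divLR ?width_gt0 //.
by have [lt eq0] := pA i; split=> [|/eq0 ->]; rewrite ?div0n // -expnSr.
Qed.

(* Contracting all coordinates but [i0], each block of [W] becomes a row with at least
   [2 ^ k] points. *)
Lemma wide_layer_bound (S : {set 'I_d}) i0 j a E (A W : {set pt}) :
    i0 \in S -> within_box S (width ^ j.+1) A -> ~ interval_minor pt_coord (dims S) A ->
    (forall B, within_box (S :\ i0) (width ^ j) B ->
       ~ interval_minor pt_coord (dims (S :\ i0)) B ->
       #|B| <= E) ->
    (forall b, b \in W -> b i0 = a :> nat /\
       2 ^ k <= #|[set p i0 | p : pt in [set p in A | contract width p == b]]|) ->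
  #|W| <= E * width ^ 2.
Proof.
move=> i0S wA Amin HE HW.
pose h (p : pt) : pt := [ffun i => if i == i0 then p i else inord (p i %/ width)].
pose X := h @: [set p in A | contract width p \in W].
have h0 p : h p i0 = p i0 by rewrite ffunE eqxx.
have hi p i : i != i0 -> h p i = p i %/ width :> nat.
  by move=> ii0; rewrite -contractE !ffunE (negPf ii0).
have zh p : zero_at i0 (h p) = zero_at i0 (contract width p).
  by apply/ffunP=> i; rewrite !ffunE; case: eqP.
have [_ memX] : True /\ forall r, r \in X ->
    exists2 p, p \in A /\ contract width p \in W & r = h p.
  by split=> // _ /imsetP[p + ->]; rewrite inE => /andP[]; exists p.
(* Here [l = k - 1], [sigma = k] and [tau = 2 * k + 1]: layer [a] spans [width] values of coordinate
   [i0]. *)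
have : #|zero_at i0 @: X| * 2 ^ k <= E * 2 ^ k.-1 * 4 ^ (2 * k).+1.
  apply: (row_bound (K := dims S) (X := X) _ (lo := a * width)) => //.
  - move=> B /subsetP BX Bmin; apply: HE.
      move=> _ /imsetP[r /BX /memX[p [pA _] ->] ->] i; rewrite zh ffunE.
      rewrite !inE; case: eqVneq => [_|ii0] /=; first by rewrite expn_gt0 width_gt0.
      rewrite contractE ltn_divLR ?width_gt0 // -expnSr.
      by have [-> eq0] := wA p pA i; split=> // /eq0 ->; rewrite div0n.
    apply: contra_not Bmin => Bm.
    have {Bm} : interval_minor pt_coord (upd (dims S) i0 1) (zero_at i0 @: B).
      apply: minor_eq Bm => i; rewrite /upd /dims !inE; by case: eqP.
    apply: (minor_image (h := fun i x => if i == i0 then 0 else x)).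
      by move=> i x y; case: eqP.
    by move=> p i _; rewrite /zero_at /pt_coord ffunE; case: eqP.
  - exact: leq_pred.
  - move=> r /memX[p [pA pW] ->]; rewrite h0.
    have [<- _] := HW _ pW; rewrite contractE.
    rewrite -/width leq_divM /= -mulSnr; exact: ltn_ceil width_gt0.
  - move=> r /memX[p [pA pW] ->]; have [_ le] := HW _ pW.
    apply: leq_trans le _.
    apply: leq_trans (leq_imset_card (fun r : pt => r i0) _).
    apply: subset_leq_card; apply/subsetP=> _ /imsetP[q + ->].
    rewrite inE => /andP[qA /eqP qp]; rewrite -h0; apply: imset_f.
    by rewrite inE !zh qp eqxx andbT imset_f // inE qA qp.
  - apply: contra_not Amin => /minor_eq -/(_ (dims S)) Xm.
    have : interval_minor pt_coord (dims S) X.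
      by apply: Xm => i; rewrite /upd /dims prednK //; case: eqP => // ->; rewrite i0S.
    move=> /(minor_image (x := pt_coord)
      (h := fun i x => if i == i0 then x else x %/ width)) Xm'.
    apply: minor_sub (Xm' _ _); first by apply/subsetP=> p; rewrite inE => /andP[].
      by move=> i x y xy; case: eqP => // _; exact: leq_div2r.
    move=> p i _; rewrite /pt_coord; case: eqP => [->|/eqP]; first by rewrite h0.
    exact: hi.
(* All of [W] has [i0]-coordinate [a], so the projection is injective on it. *)
have -> : #|W| = #|zero_at i0 @: W|.
  rewrite card_in_imset // => p q pW qW /zero_at_eq e.
  apply/ffunP=> i; case: (eqVneq i i0) => [->|/e //].
  by apply: val_inj; rewrite /= (HW p pW).1 (HW q qW).1.
move=> le; have {}le : #|zero_at i0 @: X| * 2 ^ k <= (E * width ^ 2) * 2 ^ k.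
  apply: leq_trans le _; rewrite mulnAC /width -expnM mulnC.
  rewrite -[4]/(2 ^ 2) -expnM [2 * _.+1]mulnC mulnC leq_mul2l leq_exp2l //.
  by rewrite leq_pred orbT.
rewrite leq_pmul2r ?expn_gt0 // in le; apply: leq_trans le.
apply: subset_leq_card; apply/subsetP=> _ /imsetP[b bW ->].
have [_ le] := HW b bW.
have /card_gt0P[_ /imsetP[p + _]] := leq_trans (expn_gt0 2 k : 0 < 2 ^ k) le.
by rewrite inE => /andP[pA /eqP pb]; rewrite -pb -zh imset_f // imset_f // inE pA pb.
Qed.

(** Each further dimension costs [d] for the wide direction, [width ^ 2] from the layer bound,
    [width ^ d] for the points of a block, and 2 to absorb the narrow blocks. *)
Definition ex_const (e : nat) : nat := (2 * d * width ^ d.+2) ^ e * 2 ^ k.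

Lemma leq_card_sides (A : {set pt}) :
  #|A| <= \prod_(i < d) #|[set p i | p : pt in A]|.
Proof.
pose F (i : 'I_d) : pred 'I_N.+1 := mem [set p i | p : pt in A].
apply: (@leq_trans #|(family F : simpl_pred pt)|).
  apply: subset_leq_card; apply/subsetP=> p pA; apply/familyP=> i.
  by rewrite /F inE; apply/imsetP; exists p.
by rewrite card_family foldrE big_map big_enum.
Qed.

(** A subset of a line is a single row. Any nonempty set has the minor of side 1, so the halving
    recursion applies with [E = 0] and would make a row of more than [2 ^ k] points empty. *)
Lemma ex_bound1 (S : {set 'I_d}) j (A : {set pt}) :
    #|S| = 1 -> within_box S (width ^ j) A -> ~ interval_minor pt_coord (dims S) A ->
  #|A| <= 2 ^ k.
Proof.
move=> /eqP/cards1P[i ->] wA Amin; rewrite leqNgt; apply/negP=> /ltnW big.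
have : #|zero_at i @: A| * 2 ^ k <= 0 * 2 ^ k.-1 * 4 ^ ((2 * k).+1 * j).
  apply: (row_bound (K := dims [set i]) (X := A) _ (lo := 0)) => //.
  - move=> B BA Bmin; rewrite leqn0 cards_eq0; apply/set0Pn=> -[_ /imsetP[p pB _]].
    apply: Bmin; exists (fun _ _ => 0) => // v v1; exists p => // i'.
    by have := v1 i'; rewrite /upd /dims inE; case: eqP => _; case: (v i').
  - exact: leq_pred.
  - by move=> p /wA /(_ i) [lt _]; rewrite add0n expnM.
  - move=> p pA; apply: leq_trans big _; apply: subset_leq_card.
    apply/subsetP=> q qA; rewrite inE qA; apply/eqP/ffunP=> i'.
    rewrite !ffunE; case: eqVneq => // ii0; apply: val_inj.
    by rewrite /= (wA q qA i').2 ?(wA p pA i').2 // inE.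
  - apply: contra_not Amin; apply: minor_eq => i'; rewrite /upd /dims !inE.
    by case: eqP => //; rewrite prednK.
rewrite !mul0n leqn0 muln_eq0 expn_eq0 orbF cards_eq0 imset_eq0 => /eqP A0.
by move: big; rewrite A0 cards0 leqn0 expn_eq0.
Qed.

Lemma ex_bound e (S : {set 'I_d}) j (A : {set pt}) :
    #|S| = e.+1 -> within_box S (width ^ j) A -> ~ interval_minor pt_coord (dims S) A ->
  #|A| <= ex_const e * width ^ (j * e).
Proof.
elim: e S j A => [|e IHe] S j A cS.
  rewrite muln0 /ex_const !expn0 muln1 mul1n; exact: ex_bound1.
elim: j A => [|j IHj] A wA Amin.
  have d0 : 0 < d by rewrite -[d]card_ord (leq_trans _ (max_card (mem S))) ?cS.
  rewrite mul0n expn0 muln1; apply: (@leq_trans 1).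
    rewrite -(cards1 ([ffun=> ord0] : pt)); apply: subset_leq_card.
    apply/subsetP=> p /wA p0; rewrite inE; apply/eqP/ffunP=> i; rewrite ffunE.
    by have [] := p0 i; case: (p i) => -[] // ? _ _; apply: val_inj.
  by rewrite /ex_const !(muln_gt0, expn_gt0) d0.
pose B := contract width @: A.
have cB : #|B| <= ex_const e.+1 * width ^ (j * e.+1).
  by apply: IHj; [exact: within_contract | move=> /minor_contract].
pose block b := [set p in A | contract width p == b].
pose wide i b := 2 ^ k <= #|[set p i | p : pt in block b]|.
pose A0 := [set p in A | [forall i in S, ~~ wide i (contract width p)]].
pose A1 i := [set p in A | wide i (contract width p)].
have block_card b : #|block b| <= width ^ d.
  apply: (leq_card_block (x := pt_coord) (b := pt_coord b)) => [p q e1||p].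
  - by apply/ffunP=> i; apply: val_inj; exact: e1.
  - exact: width_gt0.
  - by rewrite inE => /andP[_ /eqP <-] i; rewrite /pt_coord contractE.
have cov : A \subset A0 :|: \bigcup_(i in S) A1 i.
  apply/subsetP=> p pA; rewrite inE.
  case: (boolP (p \in A0)) => //=; rewrite inE pA /= negb_forall => /existsP[i].
  rewrite negb_imply negbK => /andP[iS wi].
  by apply/bigcupP; exists i; rewrite // inE pA.
have c0 : #|A0| <= #|B| * (2 ^ k) ^ e.+2.
  apply: (leq_card_fibers (f := contract width)) => [p|b bB].
    by rewrite inE => /andP[pA _]; exact: imset_f.
  have [->|/set0Pn[p1]] := eqVneq [set x in A0 | contract width x == b] set0.
    by rewrite cards0.
  rewrite !inE => /andP[/andP[_ /forall_inP nw] /eqP p1b].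
  apply: (@leq_trans #|block b|).
    apply: subset_leq_card; apply/subsetP=> p; rewrite !inE.
    by case/andP=> /andP[-> _].
  apply: leq_trans (leq_card_sides _) _.
  apply: (@leq_trans (\prod_(i < d) (if i \in S then 2 ^ k else 1))).
    apply: leq_prod => i _; case: ifPn => iS.
      by have := nw i iS; rewrite p1b /wide -ltnNge => /ltnW.
    rewrite -(cards1 (ord0 : 'I_N.+1)); apply: subset_leq_card.
    apply/subsetP=> _ /imsetP[p + ->]; rewrite !inE => /andP[/wA/(_ i)[_ p0] _].
    by apply/eqP/val_inj; rewrite /= p0.
  by rewrite -big_mkcond prod_nat_const cS.
have c1 i : i \in S ->
    #|A1 i| <= width ^ j * (ex_const e * width ^ (j * e) * width ^ 2) * width ^ d.
  move=> iS; pose W := [set b in B | wide i b].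
  apply: (@leq_trans (#|W| * width ^ d)).
    apply: (leq_card_fibers (f := contract width)) => [p|b _].
      by rewrite !inE => /andP[pA ->]; rewrite imset_f.
    apply: leq_trans (block_card b); apply: subset_leq_card.
    by apply/subsetP=> p; rewrite !inE => /andP[/andP[-> _]].
  rewrite leq_mul2r; apply/orP; right.
  have tj : 0 < width ^ j by rewrite expn_gt0 width_gt0.
  (* The wide blocks are sorted by coordinate [i] into [width ^ j] layers, each controlled by the
     bound one dimension lower. *)
  rewrite -{1}(card_ord (width ^ j)) -cardsT.
  apply: (leq_card_fibers (f := fun b : pt => Ordinal (ltn_pmod (b i) tj))) => // a _.
  apply: (wide_layer_bound (i0 := i) (a := a) (A := A) iS wA Amin).
    by move=> B'; apply: IHe; rewrite (cardsD1 i) iS in cS; case: cS.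
  move=> b; rewrite !inE => /andP[/andP[bB wb] /eqP <-] /=; split=> //.
  by rewrite modn_small //; have [] := within_contract wA bB i.
apply: leq_trans (subset_leq_card cov) (leq_trans (leq_card_setU _ _) _).
have {}c1 : #|\bigcup_(i in S) A1 i| <=
    d * (width ^ j * (ex_const e * width ^ (j * e) * width ^ 2) * width ^ d).
  apply: leq_trans (leq_card_bigcup _ _) _; set K := (X in d * X).
  apply: (@leq_trans (\sum_(i in S) K)); first exact: leq_sum.
  by rewrite sum_nat_const leq_mul2r -[X in _ <= X]card_ord max_card orbT.
set T := width ^ (j * e.+1) in cB *.
have two : 2 * (2 ^ k) ^ e.+2 <= width ^ e.+1.
  by rewrite /width -!expnM -expnS leq_exp2l //; clear; nia.
have P1 : 0 < width ^ e.+1 by rewrite expn_gt0 width_gt0.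
have e2 : 2 * (d * (width ^ j * (ex_const e * width ^ (j * e) * width ^ 2) *
                    width ^ d)) =
          ex_const e.+1 * T.
  rewrite /T /ex_const mulnS expnD !expnS expn0.
  move: (2 ^ k) (width ^ d) (width ^ (j * e)) (width ^ j) (_ ^ e) => b c x y a.
  by clear; lia.
(* After doubling, the narrow and the wide points each fill at most one of the two copies of the
   bound, by [two] and [e2] respectively. *)
rewrite mulSn expnD -/T -(leq_pmul2l (isT : 0 < 2)) mulnDr.
apply: leq_trans (leq_add (leq_mul (leqnn 2) c0) (leq_mul (leqnn 2) c1)) _.
rewrite e2; move: cB two P1; move: (_ ^ e.+2) (_ ^ e.+1) (ex_const _) #|B|.
by clear; move=> a b c x; nia.
Qed.

End Extremal.

(** * Counting the sets without the minor *)

Definition family_const (d k : nat) : nat := width k ^ d * ex_const d k d.-1.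

(** A set with contraction [B] is a subset of the few points lying over [B], so one refinement at
    most squares the bound obtained for scale [j]; the exponent has room for this because
    [2 <= width k ^ d.-1]. *)
Lemma family_bound d N k j (F : {set {set {ffun 'I_d -> 'I_N.+1}}}) :
    0 < k -> 2 <= d -> (forall A, A \in F -> within_box setT (width k ^ j) A) ->
    (forall A, A \in F -> ~ interval_minor pt_coord (fun=> k) A) ->
  #|F| <= 2 ^ (family_const d k * width k ^ (j * d.-1)).
Proof.
move=> k0 d2; set D := family_const d k.
have D0 : 0 < D.
  by rewrite /D /family_const /ex_const !(muln_gt0, expn_gt0) (ltnW d2).
elim: j F => [|j IH] F Fw Fm.
  pose z : {ffun 'I_d -> 'I_N.+1} := [ffun=> ord0].
  apply: (@leq_trans #|powerset [set z]|).
    apply: subset_leq_card; apply/subsetP=> A /Fw wA; rewrite inE.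
    apply/subsetP=> p /wA pA; rewrite inE; apply/eqP/ffunP=> i.
    by apply: val_inj; rewrite ffunE /=; have [] := pA i; case: (val (p i)).
  by rewrite card_powerset cards1 leq_exp2l // mul0n expn0 muln1.
pose Y := [set contract (width k) @: A | A : {set {ffun 'I_d -> 'I_N.+1}} in F].
have bm A : A \in F -> ~ interval_minor pt_coord (fun=> k) (contract (width k) @: A).
  by move=> /Fm Am /minor_contract.
have bw A : A \in F -> within_box setT (width k ^ j) (contract (width k) @: A).
  by move=> /Fw Aw; exact: within_contract.
apply: (@leq_trans (#|Y| * 2 ^ (D * width k ^ (j * d.-1)))); last first.
  apply: (@leq_trans (2 ^ (D * width k ^ (j * d.-1)) * 2 ^ (D * width k ^ (j * d.-1)))).
    rewrite leq_mul2r; apply/orP; right; apply: IH.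
      by move=> _ /imsetP[A /bw + ->].
    by move=> _ /imsetP[A /bm + ->].
  rewrite -expnD leq_exp2l // addnn -muln2 -mulnA leq_mul2l mulSn expnD mulnC.
  rewrite leq_mul2r; apply/orP; right; apply/orP; right.
  by rewrite -{1}[2]/(2 ^ 1) /width -expnM leq_exp2l //; case: (d) d2 => [|[]].
apply: (leq_card_fibers (f := fun A : {set _} => contract (width k) @: A)).
  by move=> A AF; apply/imsetP; exists A.
move=> _ /imsetP[A0 A0F ->]; set B := contract (width k) @: A0.
pose Z := [set p : {ffun 'I_d -> 'I_N.+1} | contract (width k) p \in B].
have cZ : #|Z| <= D * width k ^ (j * d.-1).
  apply: (@leq_trans (#|B| * width k ^ d)).
    apply: (leq_card_fibers (f := contract (width k))) => [p|b _].
      by rewrite inE.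
    apply: (leq_card_block (x := pt_coord) (b := pt_coord b)) => [p q e1||p].
    - by apply/ffunP=> i; apply: val_inj; exact: e1.
    - exact: width_gt0.
    - by rewrite inE => /andP[_ /eqP <-] i; rewrite /pt_coord contractE.
  rewrite mulnC /D /family_const -mulnA leq_mul2l; apply/orP; right.
  apply: (@ex_bound d N k k0 d.-1 setT); last 1 first.
  - apply: contra_not (bm _ A0F); apply: minor_eq => i.
    by rewrite /dims inE.
  - by rewrite cardsT card_ord prednK // ltnW.
  - exact: bw.
apply: (@leq_trans #|powerset Z|); last by rewrite card_powerset leq_exp2l.
apply: subset_leq_card; apply/subsetP=> A; rewrite !inE => /andP[_ /eqP eA].
by apply/subsetP=> p pA; rewrite inE -eA imset_f.
Qed.

(** * From cell sets to avoiding permutation matrices *)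

Lemma leq_prod_mean (I : finType) (E : I -> nat) c :
  \sum_i E i <= c * #|I| -> \prod_i E i <= c ^ #|I|.
Proof.
move=> le; have [I0|I0] := posnP #|I|.
  rewrite I0 big_pred0 // => i; have /card0_eq := I0; exact.
have [agm _] := @Num.Theory.leif_AGM rat I predT (fun i => (E i)%:R%R)
  (fun i _ => Num.Theory.ler0n _ (E i)).
rewrite -(@Num.Theory.ler_nat rat) GRing.Theory.natr_prod.
apply: (Order.POrderTheory.le_trans agm).
rewrite GRing.Theory.natrX; apply: Num.Theory.lerXn2r.
- by rewrite qualifE /= Num.Theory.divr_ge0 ?Num.Theory.ler0n // -GRing.Theory.natr_sum
    Num.Theory.ler0n.
- by rewrite qualifE /= Num.Theory.ler0n.
rewrite Num.Theory.ler_pdivrMr ?Num.Theory.ltr0n // -GRing.Theory.natr_sum -GRing.Theory.natrM.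
by rewrite Num.Theory.ler_nat.
Qed.

Lemma permutation_matrixP d k (P : binmx (cube d k)) i (x y : position (cube d k)) :
  permutation_matrix P -> P x -> P y -> x i = y i -> x = y.
Proof.
case/andP=> _ /forallP/(_ x)/forallP/(_ y) + Px Py e.
by rewrite Px Py /=; case: eqP => //= _ /forallP/(_ i); rewrite e eqxx.
Qed.

(** Pigeonhole: [k] entries have [k] distinct [i]-th coordinates among [k] values. *)
Lemma permutation_matrix_onto d k (P : binmx (cube d k)) i (v : 'I_k) :
  permutation_matrix P -> exists2 x : position (cube d k), P x & x i = v.
Proof.
move=> Pp; have /andP[/eqP cP _] := Pp.
pose f (x : position (cube d k)) : 'I_k := x i.
have finj : {in [set x | P x] &, injective f}.
  by move=> x y; rewrite !inE; exact: permutation_matrixP Pp.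
have /eqP e : f @: [set x | P x] == setT.
  by rewrite eqEcard subsetT cardsT card_ord (card_in_imset finj) cP leqnn.
have : v \in f @: [set x | P x] by rewrite e inE.
by case/imsetP=> x; rewrite inE => Px ->; exists x.
Qed.

Definition pos_coord d (n : 'I_d -> nat) (q : position n) (i : 'I_d) : nat := q i.

(* An all-ones interval minor selects one 1-entry of [A] in every cell of the
   k-cube; as every coordinate of [P] takes each value once, the selected entries
   sitting over [P] already form a copy of [P]. *)
Lemma minor_contained d k (P : binmx (cube d k)) (n : 'I_d -> nat) (A : binmx n) :
    permutation_matrix P ->
  interval_minor (@pos_coord d n) (fun=> k) [set q | A q] -> contained P A.
Proof.
move=> Pp [g gm gA].
have /fin_all_exists[s sP] (x : position (cube d k)) : exists q : position n,
    A q /\ forall i, g i (q i) = x i.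
  have [i|q] := gA (fun i => x i); first exact: ltn_ord.
  by rewrite inE => Aq gq; exists q.
have /fin_all_exists[r rP] (u : 'I_d * 'I_k) : exists x : position (cube d k),
    P x /\ x u.1 = u.2.
  by have [x Px xu] := permutation_matrix_onto u.1 u.2 Pp; exists x.
(* [v] goes to the [i]-th coordinate of the point selected over the entry of [P] with [i]-th
   coordinate [v]. For an entry [x] of [P] this entry is [x] itself on every axis, so its image is
   [s x]. *)
apply/existsP; exists [ffun i => [ffun v : 'I_k => s (r (i, v)) i]].
apply/andP; split.
  apply/forallP=> i; apply/forallP=> a; apply/forallP=> b; apply/implyP=> ab.
  rewrite !ffunE ltnNge; apply/negP=> /(gm i).
  rewrite (sP (r (i, a))).2 (sP (r (i, b))).2 (rP (i, a)).2 (rP (i, b)).2 /=.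
  by rewrite leqNgt ab.
apply/forallP=> x; apply/implyP=> Px.
have -> : map_position [ffun i => [ffun v : 'I_k => s (r (i, v)) i]] x = s x.
  apply/ffunP=> i; rewrite !ffunE; congr (s _ i).
  by apply: (permutation_matrixP (i := i) Pp) => //; case: (rP (i, x i)).
by case: (sP x).
Qed.

Section Avoiders.

Variables (d n : nat).
Hypotheses (d_gt0 : 0 < d) (n_gt0 : 0 < n).

Local Notation pos := (position (cube d n)).
Local Notation pt := {ffun 'I_d -> 'I_n.+1}.

Definition cell (w : nat) (q : pos) : pt := [ffun i => inord (q i %/ w)].

Lemma cellE w q i : cell w q i = q i %/ w :> nat.
Proof. by rewrite ffunE inordK // ltnS (leq_trans (leq_div _ _)) // ltnW. Qed.

Lemma card_cells_le w (B : {set pt}) : 0 < w ->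
  #|[set q | cell w q \in B]| <= #|B| * w ^ d.
Proof.
move=> w0; apply: (leq_card_fibers (f := cell w)) => [q|b _]; first by rewrite inE.
apply: (leq_card_block (x := @pos_coord d (cube d n)) (b := pt_coord b)) => //.
- by move=> p q e; apply/ffunP=> i; apply: val_inj; exact: e.
- by move=> q; rewrite inE => /andP[_ /eqP <-] i; rewrite /pt_coord cellE.
Qed.

Lemma card_permutations_over w (B : {set pt}) : 0 < w -> #|B| <= n ->
  #|[set A : binmx (cube d n) | permutation_matrix A &
       [forall q, A q ==> (cell w q \in B)]]| <= (w ^ d) ^ n.
Proof.
move=> w0 Bn; pose i0 : 'I_d := Ordinal d_gt0.
pose q0 : pos := [ffun i => Ordinal n_gt0].
pose F (x : 'I_n) : pred pos := [pred q : pos | (q i0 == x) && (cell w q \in B)].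
(* [code A x] is the entry of [A] with first coordinate [x]; the default [q0] never occurs for a
   permutation matrix. *)
pose code (A : binmx (cube d n)) : {ffun 'I_n -> pos} :=
  [ffun x : 'I_n => odflt q0 [pick q : pos | A q && (q i0 == x)]].
set X := [set A | _ & _].
have codeP (A : binmx (cube d n)) : permutation_matrix A ->
    forall x, A (code A x) /\ code A x i0 = x.
  move=> Ap x; rewrite ffunE; case: pickP => [q /andP[? /eqP]//|no].
  by have [q Aq qx] := permutation_matrix_onto i0 x Ap; have := no q; rewrite Aq qx eqxx.
have code_inj : {in X &, injective code}.
  move=> A A'; rewrite !inE => /andP[Ap _] /andP[Ap' _] e; apply/ffunP=> q.
  apply/idP/idP=> Aq.
    have [Ac ci] := codeP A' Ap' (q i0); rewrite -e in Ac ci.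
    have [Ac' _] := codeP A Ap (q i0).
    have <- : code A (q i0) = q by apply: (permutation_matrixP (i := i0) Ap).
    by rewrite e; case: (codeP A' Ap' (q i0)).
  have [Ac ci] := codeP A Ap (q i0); rewrite e in Ac ci.
  have [Ac' _] := codeP A' Ap' (q i0).
  have <- : code A' (q i0) = q by apply: (permutation_matrixP (i := i0) Ap').
  by rewrite -e; case: (codeP A Ap (q i0)).
rewrite -(card_in_imset code_inj).
apply: (@leq_trans #|(family F : simpl_pred {ffun 'I_n -> pos})|).
  apply: subset_leq_card; apply/subsetP=> _ /imsetP[A + ->]; rewrite inE.
  move=> /andP[Ap /forallP AB]; apply/familyP=> x; have [Ac ci] := codeP A Ap x.
  by rewrite !inE ci eqxx (implyP (AB _) Ac).
rewrite card_family foldrE big_map big_enum -[X in _ ^ X]card_ord.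
apply: leq_prod_mean; rewrite card_ord.
(* The slabs of constant first coordinate partition the at most [n * w ^ d] points over [B], so
   their mean size is at most [w ^ d]. *)
apply: (@leq_trans #|[set q | cell w q \in B]|); last first.
  apply: leq_trans (card_cells_le _ w0) _; by rewrite mulnC leq_mul2l Bn orbT.
rewrite -sum1_card (partition_big (fun q : pos => q i0) predT) //=.
apply: leq_sum => x _; rewrite sum1dep_card; apply: subset_leq_card.
by apply/subsetP=> q; rewrite !inE andbC.
Qed.

(** The last hypothesis serves twice: it bounds the number of possible cell sets by [2 ^ n], and the
    number of cells in each by [n]. A minor in a cell set would pull back to the matrix and yield
    [P]. *)
Lemma card_avoiders_cells k (P : binmx (cube d k)) w j :
    0 < k -> 2 <= d -> permutation_matrix P -> 0 < w -> n <= w * width k ^ j ->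
    family_const d k * width k ^ (j * d.-1) <= n ->
  #|avoiders P n| <= 2 ^ n * (w ^ d) ^ n.
Proof.
move=> k0 d2 Pp w0 nw Dn.
pose f (A : binmx (cube d n)) := cell w @: [set q | A q].
have fw A : within_box setT (width k ^ j) (f A).
  move=> _ /imsetP[q _ ->] i; rewrite inE; split=> //.
  rewrite cellE ltn_divLR // mulnC; exact: leq_trans (ltn_ord (q i)) nw.
have fm A : A \in avoiders P n -> ~ interval_minor pt_coord (fun=> k) (f A).
  rewrite inE => /andP[_ /negP]; apply: contra_not => m.
  apply: minor_contained Pp _.
  apply: (minor_image (h := fun _ x => x %/ w)) m => [i a b|q i _].
    exact: leq_div2r.
  exact: cellE.
apply: (@leq_trans (#|f @: avoiders P n| * (w ^ d) ^ n)).
  apply: (leq_card_fibers (f := f)) => [A AS|_ /imsetP[A0 A0S ->]].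
    exact: imset_f.
  have B0 : #|f A0| <= n.
    apply: leq_trans Dn; apply: (@leq_trans (ex_const d k d.-1 * width k ^ (j * d.-1))).
      apply: (@ex_bound d n k k0 d.-1 setT) => //.
        by rewrite cardsT card_ord prednK.
      apply: contra_not (fm _ A0S); apply: minor_eq => i.
      by rewrite /dims inE.
    by rewrite leq_mul2r leq_pmull ?orbT // expn_gt0 width_gt0.
  apply: leq_trans (card_permutations_over w0 B0); apply: subset_leq_card.
  apply/subsetP=> A; rewrite !inE => /andP[/andP[-> _] /eqP <-] /=.
  by apply/forallP=> q; apply/implyP=> Aq; rewrite imset_f // inE.
rewrite leq_mul2r; apply/orP; right.
apply: (@leq_trans (2 ^ (family_const d k * width k ^ (j * d.-1))));
  last by rewrite leq_exp2l.
apply: family_bound => //.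
  by move=> _ /imsetP[A _ ->].
by move=> _ /imsetP[A AS ->]; exact: fm.
Qed.

Lemma card_avoiders_trivial k (P : binmx (cube d k)) : #|avoiders P n| <= (n ^ d) ^ n.
Proof.
have B1 : #|[set [ffun=> ord0] : pt]| <= n by rewrite cards1.
apply: leq_trans (card_permutations_over n_gt0 B1); apply: subset_leq_card.
apply/subsetP=> A; rewrite !inE => /andP[-> _] /=.
apply/forallP=> q; apply/implyP=> _; rewrite inE; apply/eqP/ffunP=> i.
by apply: ord_inj; rewrite cellE ffunE divn_small ?ltn_ord.
Qed.

End Avoiders.

(** * Choice of the scale and the integral upper bound *)

Lemma leq_exp_base m n e : m <= n -> m ^ e <= n ^ e.
Proof. by move=> mn; case: e => // e; rewrite leq_exp2r. Qed.

Lemma leq_bin_exp2 n m : 'C(n, m) <= 2 ^ n.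
Proof.
elim: n m => [|n IH] [|m]; rewrite ?bin0 ?expn_gt0 // binS expnS mul2n -addnn.
exact: leq_add.
Qed.

Lemma leq_exp_ffact n m : n ^ m <= (n + m) ^_ m.
Proof.
elim: m => [|m IH]; first by rewrite ffactn0.
by rewrite addnS ffactSS expnS leq_mul // -addnS leq_addr.
Qed.

(** [n ^ n] is at most the falling factorial of [2 * n] of length [n], that is, a central binomial
    coefficient times the factorial. *)
Lemma leq_expnn_fact n : n ^ n <= 4 ^ n * n`!.
Proof.
apply: leq_trans (leq_exp_ffact n n) _; rewrite -bin_ffact leq_mul2r.
by rewrite -[4]/(2 ^ 2) -expnM mul2n -addnn leq_bin_exp2 orbT.
Qed.

(** The factors depending on [k] that the upper bound can absorb into [2 ^ (C2 * k)]. *)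
Definition exp_bounded (f : nat -> nat) : Prop :=
  exists c, forall k, 0 < k -> f k <= 2 ^ (c * k).

Lemma exp_bounded_cst a : exp_bounded (fun=> a).
Proof.
exists a => k k0; apply: leq_trans (ltnW (ltn_expl a (isT : 1 < 2))) _.
by rewrite leq_exp2l // leq_pmulr.
Qed.

Lemma exp_boundedM f g :
  exp_bounded f -> exp_bounded g -> exp_bounded (fun k => f k * g k).
Proof.
move=> [a Ha] [b Hb]; exists (a + b) => k k0.
by rewrite mulnDl expnD leq_mul ?Ha ?Hb.
Qed.

Lemma exp_boundedX f e : exp_bounded f -> exp_bounded (fun k => f k ^ e).
Proof.
move=> [a Ha]; exists (a * e) => k k0.
by rewrite mulnAC expnM leq_exp_base ?Ha.
Qed.

(** The factors come from [w * m <= 2 * n], from the size condition of [card_avoiders_cells], and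
    from rounding the grid side down to a power of [width k]. *)
Definition growth_const (e k : nat) : nat :=
  2 ^ e.+1 * family_const e.+2 k * width k ^ e.+1.

Lemma exp_bounded_growth_const e : exp_bounded (growth_const e).
Proof.
have ttb : exp_bounded width.
  exists 3 => k k0; rewrite /width leq_exp2l //; lia.
apply: exp_boundedM; last exact: exp_boundedX.
apply: exp_boundedM; first exact: exp_bounded_cst.
apply: exp_boundedM; first exact: exp_boundedX.
apply: exp_boundedM; last by exists 1 => k _; rewrite mul1n.
apply: exp_boundedX; apply: exp_boundedM; last exact: exp_boundedX.
exact: exp_bounded_cst.
Qed.

Lemma card_avoiders_growth e k (P : binmx (cube e.+2 k)) n :
    0 < k -> 0 < n -> permutation_matrix P ->
  exists2 w, #|avoiders P n| <= 2 ^ n * (w ^ e.+2) ^ n &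
             w ^ e.+1 <= growth_const e k * n ^ e.
Proof.
move=> k0 n0 Pp; rewrite /growth_const; set D := family_const e.+2 k.
have t0 := width_gt0 k.
have [nD|Dn] := ltnP n D.
  (* Below [D] a single cell of side [n] suffices, since [n ^ e.+1 <= D * n ^ e]. *)
  exists n.
    apply: leq_trans (card_avoiders_trivial (isT : 0 < e.+2) n0 P) _.
    by rewrite leq_pmull // expn_gt0.
  rewrite expnS leq_mul2r; apply/orP; right; apply: leq_trans (ltnW nD) _.
  by rewrite mulnAC leq_pmull // muln_gt0 !expn_gt0.
have D0 : 0 < D by rewrite /D /family_const /ex_const !(muln_gt0, expn_gt0).
have p1 : 1 < width k ^ e.+1 by rewrite -(exp1n e.+1) ltn_exp2r // -(expn0 2) ltn_exp2l.
have nD0 : 0 < n %/ D by rewrite divn_gt0.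
(* [j] is maximal with [D * width k ^ (e.+1 * j) <= n]. *)
have /andP[] := trunc_log_bounds p1 nD0; set j := trunc_log _ _.
rewrite leq_divRL // ltn_divLR // [_ ^ j.+1]expnS -(expnM (width k)) => lo hi.
pose m := width k ^ j; have m0 : 0 < m by rewrite expn_gt0 t0.
have mm : m ^ e.+1 = width k ^ (e.+1 * j) by rewrite -(expnM (width k)) mulnC.
have mn : m <= n.
  apply: leq_trans lo; rewrite -mm -[X in X <= _]muln1 leq_mul //.
  by rewrite expnS leq_pmulr // expn_gt0 m0.
pose w := (n %/ m).+1; exists w.
  apply: (@card_avoiders_cells _ _ _ n0 k P w j) => //; last first.
    by rewrite /= [j * _]mulnC mulnC.
  by rewrite -/m ltnW // ltn_ceil.
have wm : w * m <= 2 * n.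
  rewrite mulSn; have := leq_divM n m; lia.
rewrite -(leq_pmul2r n0) -[_ * n ^ e * n]mulnA -expnSr.
apply: leq_trans (leq_mul (leqnn _) (ltnW hi)) _.
have := leq_exp_base e.+1 wm; rewrite !expnMn mm.
move: (w ^ e.+1) (width k ^ (e.+1 * j)) (width k ^ e.+1) (2 ^ e.+1) (n ^ e.+1).
move=> a b c x y; clear.
move=> le; apply: (@leq_trans ((a * b) * (D * c))); first by lia.
apply: (@leq_trans ((x * y) * (D * c))); last by lia.
by rewrite leq_mul2r le orbT.
Qed.

(** For [d = e + 2] the exponent [d - 1 - 1/(d - 1)] is [(e + 2) * e / (e + 1)], so raising to the
    power [e + 1] leaves natural numbers only. *)
Lemma avoiders_upper_nat e : exists c, forall k (P : binmx (cube e.+2 k)) n,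
    0 < k -> 0 < n -> permutation_matrix P ->
  #|avoiders P n| ^ e.+1 <= 2 ^ (c * k * n) * n`! ^ (e.+2 * e).
Proof.
have [c Hc] : exp_bounded (fun k =>
    2 ^ e.+1 * growth_const e k ^ e.+2 * 4 ^ (e.+2 * e)).
  apply: exp_boundedM; last exact: exp_bounded_cst.
  apply: exp_boundedM; first exact: exp_bounded_cst.
  exact/exp_boundedX/exp_bounded_growth_const.
exists c => k P n k0 n0 Pp; have [w le wG] := card_avoiders_growth k0 n0 Pp.
apply: leq_trans (leq_exp_base e.+1 le) _; rewrite expnMn.
have -> : ((w ^ e.+2) ^ n) ^ e.+1 = ((w ^ e.+1) ^ e.+2) ^ n.
  by rewrite -!expnM; congr (_ ^ _); lia.
apply: leq_trans (leq_mul (leqnn _) (leq_exp_base n (leq_exp_base e.+2 wG))) _.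
have := leq_exp_base (e.+2 * e) (leq_expnn_fact n); rewrite expnMn => nf.
apply: (@leq_trans ((2 ^ e.+1 * growth_const e k ^ e.+2) ^ n *
                    (n ^ n) ^ (e.+2 * e))).
  rewrite [in X in X <= _]expnMn [in X in _ * X]expnMn [in X in _ <= X]expnMn.
  have -> : ((n ^ e) ^ e.+2) ^ n = (n ^ n) ^ (e.+2 * e).
    by rewrite -!expnM; congr (_ ^ _); lia.
  by rewrite [(2 ^ n) ^ _]expnAC mulnA.
apply: leq_trans (leq_mul (leqnn _) nf) _; rewrite mulnA leq_mul2r.
rewrite [(4 ^ n) ^ _]expnAC -expnMn [2 ^ (c * k * n)]expnM; apply/orP; right; exact/leq_exp_base/Hc.
Qed.

(** * Monotone subpatterns and the lower bound *)

(** [s] is a sign: [false] when [f] and [g] increase together, [true] when one reverses the order of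
    the other. *)
Definition same_order (T : finType) (f g : T -> nat) (Y : {set T}) (s : bool) : Prop :=
  {in Y &, forall x y, x != y -> (f x < f y) (+) (g x < g y) = s}.

Lemma injective_subset (T : finType) (T' : Type) (f : T -> T') (X Y : {set T}) :
  Y \subset X -> {in X &, injective f} -> {in Y &, injective f}.
Proof. by move=> /subsetP YX fi x y /YX xX /YX yX; exact: fi. Qed.

(* Induction on [a]: either the minimal elements for the product order form the second
   alternative, or they can be removed and one of them then extends the chain found. *)
Lemma erdos_szekeres (T : finType) (f g : T -> nat) a b (X : {set T}) :
    {in X &, injective f} -> {in X &, injective g} -> a * b < #|X| ->
  (exists Y : {set T}, [/\ Y \subset X, a < #|Y| & same_order f g Y false]) \/
  (exists Y : {set T}, [/\ Y \subset X, b < #|Y| & same_order f g Y true]).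
Proof.
elim: a X => [|a IH] X fi gi cX.
  have /card_gt0P[x xX] : 0 < #|X| by rewrite mul0n in cX.
  left; exists [set x]; rewrite sub1set xX cards1; split=> // y z.
  by rewrite !inE => /eqP-> /eqP->; rewrite eqxx.
pose M := [set y in X | [forall z in X, ~~ ((f z < f y) && (g z < g y))]].
have subM : M \subset X by apply/subsetP=> x; rewrite inE => /andP[].
have [Mb|bM] := leqP #|M| b; last first.
  right; exists M; split=> // x y; rewrite !inE.
  move=> /andP[xX /forall_inP xm] /andP[yX /forall_inP ym] xy.
  have fxy : f x != f y by apply: contraNneq xy => /(fi _ _ xX yX) ->.
  have gxy : g x != g y by apply: contraNneq xy => /(gi _ _ xX yX) ->.
  have := xm y yX; have := ym x xX; move: fxy gxy; clear.
  by case: (ltngtP (f x) (f y)); case: (ltngtP (g x) (g y)).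
have subXM : X :\: M \subset X by apply: subsetDl.
have [|||[Y [YX aY Yo]]|[Y [YX bY Yo]]] := IH (X :\: M).
- exact: injective_subset subXM fi.
- exact: injective_subset subXM gi.
- by rewrite cardsD (setIidPr subM); move: cX Mb; clear; lia.
- have /card_gt0P[y0 y0Y] : 0 < #|Y| by apply: leq_ltn_trans aY.
  (* The bottom [y] of the chain is not minimal in [X], so some [z] lies below it and hence below
     the whole chain. *)
  case: (arg_minnP f y0Y) => y yY ymin.
  have := subsetP YX _ yY; rewrite !inE negb_and negb_forall => /andP[].
  move=> /orP[/negP//|/existsP[z +]] yX; rewrite negb_imply negbK.
  move=> /and3P[zX fzy gzy]; left; exists (z |: Y); split.
  + by rewrite subUset sub1set zX (subset_trans YX subXM).
  + rewrite cardsU1 (_ : z \notin Y) //; apply/negP=> /ymin.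
    by rewrite leqNgt fzy.
  + have zlt y' : y' \in Y -> f z < f y' /\ g z < g y'.
      move=> y'Y; have fy := ymin y' y'Y; split; first exact: leq_trans fzy fy.
      case: (eqVneq y y') => [<- //|yy'].
      have fyy' : f y < f y'.
        have y'X := subsetP (subset_trans YX subXM) _ y'Y.
        rewrite ltn_neqAle fy andbT.
        by apply: contraNneq yy' => /(fi _ _ yX y'X) ->.
      have := Yo _ _ yY y'Y yy'; rewrite fyy'.
      by case: (ltnP (g y) (g y')) => // lt _; exact: ltn_trans gzy lt.
    move=> u v; rewrite !inE => /orP[/eqP->|uY] /orP[/eqP->|vY] uv.
    * by rewrite eqxx in uv.
    * by have [-> ->] := zlt v vY.
    * have [fl gl] := zlt u uY.
      by rewrite [f u < _]ltnNge (ltnW fl) [g u < _]ltnNge (ltnW gl).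
    * exact: Yo.
- right; exists Y; split=> //; exact: subset_trans YX subXM.
Qed.

Lemma same_order_sub (T : finType) (f g : T -> nat) (Y Z : {set T}) s :
  Z \subset Y -> same_order f g Y s -> same_order f g Z s.
Proof. by move=> /subsetP ZY Yo x y /ZY xY /ZY yY; exact: Yo. Qed.

(** Each further function costs one square root of the size. *)
Lemma erdos_szekeres_seq (T : finType) (I : eqType) (f : T -> nat) (g : I -> T -> nat)
    (r : seq I) (X : {set T}) :
    {in X &, injective f} -> (forall i, {in X &, injective (g i)}) ->
  exists Y : {set T}, [/\ Y \subset X, #|X| <= #|Y| ^ (2 ^ size r) &
    forall i, i \in r -> exists s, same_order f (g i) Y s].
Proof.
move=> fi gi; elim: r => [|i r [Y [YX cY Yo]]].
  by exists X; split; rewrite ?expn0 ?expn1.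
have [Y0|Y0] := posnP #|Y|.
  exists Y; split=> // [|j _].
    by move: cY; rewrite Y0 !exp0n ?expn_gt0.
  by exists true => x; rewrite (cards0_eq Y0) inE.
(* The square root of [#|Y|], rounded so that [a' * a'] stays strictly below [#|Y|]. *)
have [a' lo hi] : exists2 a, a * a < #|Y| & #|Y| <= a.+1 ^ 2.
  have ex : exists a, #|Y| <= a.+1 ^ 2.
    by exists #|Y|; rewrite -mulnn (leq_trans (leqnSn _)) // leq_pmulr.
  case: (ex_minnP ex) => -[|b] Hb minb; first by exists 0.
  exists b.+1 => //; rewrite ltnNge; apply/negP=> le.
  by have := minb b; rewrite -mulnn le ltnn => /(_ isT).
have finish s (Z : {set T}) : Z \subset Y -> a' < #|Z| -> same_order f (g i) Z s ->
  exists Y : {set T}, [/\ Y \subset X, #|X| <= #|Y| ^ (2 ^ size (i :: r)) &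
    forall j, j \in i :: r -> exists s, same_order f (g j) Y s].
  move=> ZY aZ Zo; exists Z; split.
  - exact: subset_trans YX.
  - apply: leq_trans cY _; rewrite /= expnS expnM; apply: leq_exp_base.
    exact: leq_trans hi (leq_exp_base 2 aZ).
  - move=> j; rewrite inE => /orP[/eqP ->|/Yo [s' so]]; first by exists s.
    by exists s'; exact: same_order_sub so.
have [||[Z [ZY aZ Zo]]|[Z [ZY aZ Zo]]] := @erdos_szekeres T f (g i) a' a' Y _ _ lo.
- exact: injective_subset YX fi.
- exact: injective_subset YX (gi i).
- exact: finish Zo.
- exact: finish Zo.
Qed.

(** All coordinates are compared with coordinate 0, so only the other [e] cost a square root. *)
Lemma monotone_subpattern e k (P : binmx (cube e.+1 k)) : permutation_matrix P ->
  exists (Y : {set position (cube e.+1 k)}) (s : 'I_e.+1 -> bool),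
    [/\ Y \subset [set x | P x], k <= #|Y| ^ (2 ^ e) &
    forall i, same_order (fun x : position (cube e.+1 k) => x ord0 : nat)
                         (fun x => x i : nat) Y (s i)].
Proof.
move=> Pp; pose X := [set x : position (cube e.+1 k) | P x].
pose g i (x : position (cube e.+1 k)) : nat := x i.
have gi i : {in X &, injective (g i)}.
  move=> x y; rewrite !inE => Px Py e'.
  by apply: (permutation_matrixP (i := i) Pp) => //; exact: val_inj.
have [Y [YX cY Yo]] := erdos_szekeres_seq [seq lift ord0 i | i <- enum 'I_e]
  (gi ord0) gi.
rewrite size_map size_enum_ord in cY.
have /fin_all_exists[s sP] i : exists s, same_order (g ord0) (g i) Y s.
  case: (unliftP ord0 i) => [j ->|->].
    by apply: Yo; rewrite map_f // mem_enum.
  by exists false => x y _ _ _; rewrite addbb.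
exists Y, s; split=> //; apply: leq_trans cY.
by case/andP: Pp => /eqP c _; apply: eq_leq; rewrite -[LHS]c.
Qed.

(** * Distributing points over prescribed cells *)

Lemma sorting_perm n (f : 'I_n -> nat) :
  exists s : {perm 'I_n}, {homo (fun x => f (s x)) : x y / (x <= y)%N}.
Proof.
have /tuple_permP[p eqp] : perm_eq (sort (relpre f leq) (ord_tuple n)) (ord_tuple n).
  by rewrite perm_sort.
exists p => x y xy.
have trf : transitive (relpre f leq) by move=> ? ? ?; exact: leq_trans.
have tof : total (relpre f leq) by move=> ? ?; exact: leq_total.
have /(sorted_leq_nth trf (fun z => leqnn _) x) := sort_sorted tof (ord_tuple n).
move=> /(_ x y); rewrite !inE size_sort size_tuple !ltn_ord => /(_ isT isT xy) /=.
by rewrite eqp -!tnth_nth !tnth_mktuple !tnth_ord_tuple.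
Qed.

(* The permutations [t] with [s \o t = f] form a fibre of [t |-> f \o t] up to
   translation, and this map has at most [M ^ n] values. *)
Lemma card_sorting_perms n M (f : 'I_n -> 'I_M) :
  exists2 s : 'I_n -> nat, {homo s : x y / (x <= y)%N} &
    n`! <= M ^ n * #|[set t : {perm 'I_n} | [forall p, s (t p) == f p]]|.
Proof.
have [u us] := sorting_perm (fun p => f p).
exists (fun p => f (u p)) => //.
rewrite -card_Sn -cardsT; apply: (@leq_trans (#|[set: {ffun 'I_n -> 'I_M}]| *
  #|[set t : {perm 'I_n} | [forall p, f (u (t p)) == f p :> nat]]|)); last first.
  by rewrite cardsT card_ffun !card_ord.
apply: (leq_card_fibers (f := fun t : {perm 'I_n} => [ffun p => f (t p)])) => // h _.
set Z := [set t in _ | _].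
have [->|/set0Pn[t0 t0Z]] := eqVneq Z set0; first by rewrite cards0.
have ZP t : t \in Z -> forall p, f (t p) = h p.
  by rewrite inE => /andP[_ /eqP <-] p; rewrite ffunE.
pose sh (t : {perm 'I_n}) := (t0^-1 * t * u^-1)%g.
have shi : injective sh by move=> t t' /mulIg /mulgI.
rewrite -(card_imset _ shi); apply: subset_leq_card; apply/subsetP=> _ /imsetP[t tZ ->].
rewrite inE; apply/forallP=> p; rewrite !permM permKV (ZP t) // -(ZP t0) //.
by rewrite permKV.
Qed.

(** The reversed case sorts the reflected labels and reflects back. It allows each axis to be cut in
    the direction in which the pattern runs. *)
Lemma card_signed_sorting_perms n M (eps : bool) (f : 'I_n -> 'I_M) :
  exists2 s : 'I_n -> nat,
    forall x y, s x < s y -> if eps then y < x else x < y &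
    n`! <= M ^ n * #|[set t : {perm 'I_n} | [forall p, s (t p) == f p]]|.
Proof.
case: eps; last first.
  have [s sm cs] := card_sorting_perms f; exists s => // x y.
  by apply: contraTT; rewrite -!leqNgt; exact: sm.
have [s sm cs] := card_sorting_perms (fun p => rev_ord (f p)).
exists (fun x => M - (s x).+1) => [x y|].
  apply: contraTT; rewrite -!leqNgt => /sm le; exact: leq_sub2l.
apply: leq_trans cs _; rewrite leq_mul2l; apply/orP; right.
apply: subset_leq_card; apply/subsetP=> t; rewrite !inE => /forallP tP.
apply/forallP=> p; have /eqP -> := tP p; rewrite /=.
by apply/eqP; have := ltn_ord (f p); clear; lia.
Qed.

(* Cells [(x, r)] with [x] in [m]^e and [r < l]; coordinate 0 is [e m - sum x + r], so that
   the coordinate sum [e m + r] depends on [r] only. *)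
Lemma incomparable_cells e n l m : n <= m ^ e * l -> l <= m ->
  exists (c : 'I_n -> 'I_e.+1 -> 'I_(e.+1 * m)) (r : 'I_n -> 'I_l),
    (forall p q, c p =1 c q -> p = q) /\
    (forall p q, p != q -> r p = r q -> exists i, c p i < c q i).
Proof.
move=> nml lm; pose C := ({ffun 'I_e -> 'I_m} * 'I_l)%type.
have nC : n <= #|{: C}| by rewrite card_prod card_ffun !card_ord.
pose u (p : 'I_n) : C := enum_val (widen_ord nC p).
have ui : injective u.
  by move=> p q /enum_val_inj /(congr1 val) /= e'; exact: val_inj.
pose total (x : {ffun 'I_e -> 'I_m}) := \sum_i (x i : nat).
have total_le x : total x <= e * m.
  rewrite -[e in e * m]card_ord -sum_nat_const; apply: leq_sum => i _.
  exact: ltnW (ltn_ord _).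
have lt0 (z : C) : e * m - total z.1 + z.2 < e.+1 * m.
  have := ltn_ord z.2; rewrite mulSn; move: lm; clear; lia.
have m0 (z : C) : 0 < e.+1 * m by apply: leq_ltn_trans (lt0 z).
have ltS (z : C) i : z.1 i < e.+1 * m.
  by rewrite mulSn ltn_addr // ltn_ord.
pose c p (i : 'I_e.+1) : 'I_(e.+1 * m) :=
  if unlift ord0 i is Some j then Ordinal (ltS (u p) j) else Ordinal (lt0 (u p)).
have c0 p' : c p' ord0 = e * m - total (u p').1 + (u p').2 :> nat.
  by rewrite /c unlift_none.
have cS p' j : c p' (lift ord0 j) = (u p').1 j :> nat by rewrite /c liftK.
have inj1 p q : (u p).1 =1 (u q).1 -> (u p).2 = (u q).2 -> p = q.
  move=> e1 e2; apply: ui; move: e1 e2; case: (u p) => x a; case: (u q) => y b /=.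
  by move=> /ffunP -> ->.
exists c, (fun p => (u p).2); split=> p q => [cpq|pq rpq].
  have e1 : (u p).1 = (u q).1.
    by apply/ffunP=> j; apply: val_inj; rewrite /= -!cS cpq.
  apply: inj1 => [j|]; first by rewrite e1.
  apply: val_inj; have := congr1 val (cpq ord0); rewrite /= !c0 e1.
  exact: addnI.
apply/existsP; case: (boolP [exists i, c p i < c q i]) => //.
rewrite negb_exists => /forallP no.
have le j : (u q).1 j <= (u p).1 j by rewrite -!cS leqNgt; exact: no.
have eq_sum : total (u q).1 = total (u p).1.
  apply/eqP; rewrite eqn_leq leq_sum //=.
  have := no ord0; rewrite !c0 rpq -leqNgt leq_add2r.
  by have := total_le (u p).1; have := total_le (u q).1; clear; lia.
have eqj j : (u q).1 j = (u p).1 j.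
  have [_ ] := leqif_sum (fun i (_ : true) => leqif_eq (le i)).
  rewrite -/(total (u q).1) -/(total (u p).1) eq_sum eqxx => /esym/forall_inP/(_ j isT)/eqP.
  exact: val_inj.
by case/eqP: pq; apply: inj1 => // j; rewrite eqj.
Qed.

Section Tuples.

Variables d n : nat.
Hypothesis d_gt0 : 0 < d.

Definition tuple_point (t : {ffun 'I_d -> {perm 'I_n}}) (p : 'I_n) : position (cube d n) :=
  [ffun i => t i p].

Definition matrix_of (t : {ffun 'I_d -> {perm 'I_n}}) : binmx (cube d n) :=
  [ffun y => [exists p, tuple_point t p == y]].

Lemma point_inj t i p q : tuple_point t p i = tuple_point t q i -> p = q.
Proof. by rewrite !ffunE => /perm_inj. Qed.

Lemma matrix_ofP t y : reflect (exists p, y = tuple_point t p) (matrix_of t y).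
Proof.
by rewrite ffunE; apply: (iffP existsP) => -[p]; [move/eqP|move=> ->]; exists p.
Qed.

Lemma matrix_of_permutation t : permutation_matrix (matrix_of t).
Proof.
apply/andP; split.
  have -> : [set x | matrix_of t x] = [set tuple_point t p | p in 'I_n].
    apply/setP=> y; rewrite inE; apply/matrix_ofP/imsetP=> [[p ->]|[p _ ->]];
    by exists p.
  rewrite card_imset ?card_ord // => p q e.
  by apply: (@point_inj t (Ordinal d_gt0)); rewrite e.
apply/forallP=> x; apply/forallP=> y; apply/implyP.
case/and3P=> /matrix_ofP[p ->] /matrix_ofP[q ->] pq.
apply/forallP=> i; apply: contraNneq pq => /point_inj ->; exact: eqxx.
Qed.

(** The diagonal matrix avoids [P], as [k] indices cannot be injected into [n < k]. *)
Lemma card_avoiders_small k (P : binmx (cube d k)) : n < k -> 0 < #|avoiders P n|.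
Proof.
move=> nk; apply/card_gt0P; exists (matrix_of [ffun=> 1%g]).
rewrite inE matrix_of_permutation; apply/negP=> /existsP[f /andP[/forallP fi _]].
have := fi (Ordinal d_gt0) => {}fi.
have fj : injective (f (Ordinal d_gt0)).
  move=> a b e; case: (ltngtP a b) => [ab|ab|/val_inj //].
    by have := implyP (forallP (forallP fi a) b) ab; rewrite e ltnn.
  by have := implyP (forallP (forallP fi b) a) ab; rewrite e ltnn.
by have := leq_card _ fj; rewrite !card_ord leqNgt nk.
Qed.

End Tuples.

(** [X] collects the tuples placing point [p] in cell [c p], the axes being labelled by [s] in the
    direction given by [eps]. In a copy of [P], two of the more than [l] entries of [Y] share a
    class of [r]; their cells are incomparable, so each is smaller on some axis, and the signs turn
    this into contradictory orders of coordinate 0. *)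
Lemma card_avoiders_lower e k (P : binmx (cube e.+1 k)) n l m
    (Y : {set position (cube e.+1 k)}) (eps : 'I_e.+1 -> bool) :
    permutation_matrix P -> Y \subset [set x | P x] ->
    (forall i, same_order (fun x : position (cube e.+1 k) => x ord0 : nat)
                          (fun x => x i : nat) Y (eps i)) ->
    0 < n -> l < #|Y| -> n <= m ^ e * l -> l <= m ->
  n`! ^ e.+1 <= ((e.+1 * m) ^ n) ^ e.+1 * #|avoiders P n|.
Proof.
move=> Pp /subsetP YP Yo n0 lY nml lm.
have [c [r [ci cr]]] := incomparable_cells nml lm.
have /fin_all_exists2[s sm cs] i := card_signed_sorting_perms (eps i) (fun p => c p i).
set M := (e.+1 * m) ^ n in cs *.
pose F i : pred {perm 'I_n} := mem [set t : {perm 'I_n} | [forall p, s i (t p) == c p i]].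
pose X := [set t : {ffun 'I_e.+1 -> {perm 'I_n}} | t \in family F].
have XP t : t \in X -> forall i p, s i (t i p) = c p i.
  rewrite inE => /familyP tF i p; have := tF i; rewrite !inE => /forallP/(_ p).
  by move/eqP.
have cX : #|X| = \prod_(i < e.+1) #|F i|.
  by rewrite cardsE card_family foldrE big_map big_enum.
apply: (@leq_trans (M ^ e.+1 * #|X|)).
  rewrite cX -[X in _ ^ X * _]card_ord -[X in _ <= X * _]prod_nat_const -big_split /=.
  rewrite -[X in _ ^ X]card_ord -prod_nat_const; apply: leq_prod => i _.
  exact: cs.
(* A point determines its cell and distinct indices have distinct cells, so on [X] the matrix
   determines the tuple. *)
have pt_inj t t' p q : t \in X -> t' \in X -> tuple_point t p = tuple_point t' q -> p = q.
  move=> tX t'X /ffunP ept; apply: ci => i; apply: val_inj.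
  rewrite /= -(XP t tX) -(XP t' t'X); congr (s i _).
  by have := ept i; rewrite !ffunE.
rewrite leq_mul2l; apply/orP; right.
rewrite -(@card_in_imset _ _ (@matrix_of e.+1 n)); last first.
  move=> t t' tX t'X emx; apply/ffunP=> i; apply/permP=> p.
  have /matrix_ofP[q eq] : matrix_of t' (tuple_point t p).
    by rewrite -emx; apply/matrix_ofP; exists p.
  have epq := pt_inj _ _ _ _ tX t'X eq; move: eq; rewrite -epq => /ffunP/(_ i).
  by rewrite !ffunE.
apply: subset_leq_card; apply/subsetP=> _ /imsetP[t tX ->].
rewrite inE matrix_of_permutation //=; apply/negP=> /existsP[f /andP[/forallP fi /forallP fP]].
have fm i (a b : 'I_k) : a < b -> f i a < f i b.
  exact: implyP (forallP (forallP (fi i) a) b).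
have /fin_all_exists[w wP] (x : position (cube e.+1 k)) :
    exists p : 'I_n, P x -> map_position f x = tuple_point t p.
  have := fP x; case: (P x) => /= [/matrix_ofP[p ep]|_]; first by exists p.
  by exists (Ordinal n0).
have tw x i : x \in Y -> t i (w x) = f i (x i).
  by move=> /YP; rewrite inE => /wP/ffunP/(_ i); rewrite !ffunE.
have key x y i : x \in Y -> y \in Y -> x != y -> c (w x) i < c (w y) i ->
    x ord0 < y ord0.
  move=> xY yY xy; have fmV (a b : 'I_k) : f i a < f i b -> a < b.
    apply: contraTT; rewrite -!leqNgt leq_eqVlt => /orP[/eqP/val_inj -> //|].
    by move=> /fm /ltnW.
  rewrite -!(XP t tX) => /sm; rewrite !tw //.
  have := Yo i x y xY yY xy; case: (eps i) => + /fmV lt; last by rewrite lt addbT => /negbFE.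
  by rewrite [x i < _]ltnNge (ltnW lt) addbF.
have [x xY [y yY /andP[xy /eqP rxy]]] : exists2 x, x \in Y &
    exists2 y, y \in Y & (x != y) && (r (w x) == r (w y)).
  case: (boolP [exists x in Y, [exists y in Y, (x != y) && (r (w x) == r (w y))]]).
    by move=> /exists_inP[x xY /exists_inP ?]; exists x.
  rewrite negb_exists_in => /forall_inP no.
  have rwi : {in Y &, injective (r \o w)}.
    move=> x y xY yY /= e'; apply/eqP; have := no x xY.
    by rewrite negb_exists_in => /forall_inP/(_ y yY); rewrite e' eqxx andbT negbK.
  by have := leq_card_in _ _ rwi; rewrite card_ord leqNgt lY.
have wxy : w x != w y.
  apply: contraNneq xy => ew; apply/eqP.
  have := tw x ord0 xY; rewrite ew tw // => ef.
  have Px := YP _ xY; have Py := YP _ yY; rewrite !inE in Px Py.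
  apply: (permutation_matrixP (i := ord0) Pp) => //.
  by case: (ltngtP (x ord0) (y ord0)) => [/(fm ord0)|/(fm ord0)|/val_inj //]; rewrite ef ltnn.
have [i /(key x y i xY yY xy) lt1] := cr _ _ wxy rxy.
have [j /(key y x j yY xY)] : exists j, c (w y) j < c (w x) j.
  by apply: cr; rewrite // eq_sym.
by rewrite eq_sym => /(_ xy); rewrite ltnNge ltnW.
Qed.

Lemma avoiders_lower_nat e : exists2 c, 0 < c & forall k (P : binmx (cube e.+2 k)) n,
    2 <= k -> k <= n -> permutation_matrix P ->
  exists2 l, k <= (2 * l) ^ (2 ^ e.+1) &
    n`! ^ (e.+2 * e) * l ^ n <= c ^ n * #|avoiders P n| ^ e.+1.
Proof.
(* [e.+2] comes from the grid side [e.+2 * m], 2 from rounding [m], and 4 from [leq_expnn_fact]. *)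
exists (((e.+2 * 2) ^ e.+1 * 4) ^ e.+2) => [|k P n k2 kn Pp].
  by rewrite !(expn_gt0, muln_gt0).
have [Y [eps [YP cY Yo]]] := monotone_subpattern Pp.
have exl : exists a, k <= a ^ (2 ^ e.+1) by exists #|Y|.
(* [l.+1] is the rounded-up root of [k]; since [k >= 2], [l] is positive and [l.+1 <= 2 * l].
   Minimality also gives [l < #|Y|]. *)
case: (ex_minnP exl) => -[|l] Hl minl.
  by move: Hl; rewrite exp0n ?expn_gt0 // leqNgt ltnW.
have e20 : 0 < 2 ^ e.+1 by rewrite expn_gt0.
have l0 : 0 < l by case: l Hl {minl} => //; rewrite exp1n leqNgt k2.
have lk : l ^ (2 ^ e.+1) < k.
  by rewrite ltnNge; apply/negP=> /minl; rewrite ltnn.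
exists l; first by apply: leq_trans Hl _; apply: leq_exp_base; move: l0; clear; lia.
have n0 : 0 < n by apply: leq_trans kn; exact: ltnW.
have ex : exists m, n <= m ^ e.+1 * l.
  by exists n; rewrite (leq_trans _ (leq_pmulr _ l0)) // -{1}(expn1 n) leq_pexp2l.
case: (ex_minnP ex) => m Hm minm.
(* Otherwise [m ^ e.+1 * l <= l ^ e.+2 <= l ^ (2 ^ e.+1) < k <= n]. *)
have lm : l <= m.
  rewrite leqNgt; apply/negP=> ml; have : m ^ e.+1 * l < n.
    apply: leq_trans kn; apply: leq_trans lk; rewrite ltnS.
    apply: (@leq_trans (l ^ e.+1 * l)); first by rewrite leq_mul // leq_exp_base // ltnW.
    by rewrite -expnSr leq_pexp2l // ltn_expl.
  by rewrite ltnNge Hm.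
have ll : l <= l ^ (2 ^ e.+1) by rewrite -{1}(expn1 l) leq_pexp2l.
have m1 : 1 < m.
  rewrite ltnNge; apply/negP=> m1; have := leq_trans Hm (leq_mul (leq_exp_base e.+1 m1) (leqnn l)).
  by rewrite exp1n mul1n; move: ll lk kn; clear; lia.
(* As [1 < m], [m <= 2 * m.-1], and [m.-1] is too small by minimality. *)
have mn : m ^ e.+1 * l <= 2 ^ e.+1 * n.
  have lt : m.-1 ^ e.+1 * l < n.
    by rewrite ltnNge; apply/negP=> /minm; move: m1; clear; lia.
  apply: (@leq_trans ((2 * m.-1) ^ e.+1 * l)).
    by rewrite leq_mul // leq_exp_base //; move: m1; clear; lia.
  by rewrite expnMn -mulnA leq_mul2l (ltnW lt) orbT.
have low := card_avoiders_lower Pp YP Yo n0 (minl _ cY) Hm lm.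
set S := #|avoiders P n| in low *.
have low' : n`! ^ (e.+2 * e) * n`! ^ e.+2 * l ^ (n * e.+2) <=
    ((e.+2 * 2) ^ e.+1) ^ (n * e.+2) * ((4 ^ n) ^ e.+2 * n`! ^ e.+2) * S ^ e.+1.
  rewrite -expnD addnC -mulnS expnM.
  apply: leq_trans (leq_mul (leq_exp_base e.+1 low) (leqnn _)) _.
  rewrite expnMn mulnAC leq_mul2r; apply/orP; right.
  have -> : (((e.+2 * m) ^ n) ^ e.+2) ^ e.+1 = (e.+2 ^ e.+1 * m ^ e.+1) ^ (n * e.+2).
    by rewrite -expnMn -!expnM; congr (_ ^ _); clear; lia.
  rewrite -expnMn -mulnA.
  apply: leq_trans (leq_exp_base _ (leq_mul (leqnn _) mn)) _.
  rewrite mulnA -expnMn expnMn leq_mul2l; apply/orP; right.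
  by rewrite expnM -expnMn leq_exp_base // leq_expnn_fact.
rewrite -(leq_pmul2r (_ : 0 < n`! ^ e.+2)) ?expn_gt0 ?fact_gt0 //.
apply: (@leq_trans (n`! ^ (e.+2 * e) * n`! ^ e.+2 * l ^ (n * e.+2))).
  by rewrite mulnAC leq_mul2l leq_pexp2l ?orbT // leq_pmulr.
apply: leq_trans low' _; rewrite mulnAC mulnA leq_mul2r; apply/orP; right.
rewrite mulnAC leq_mul2r; apply/orP; right.
apply: eq_leq; rewrite -[(4 ^ n) ^ _]expnM -expnMn -expnM.
by rewrite [n * _]mulnC.
Qed.

Lemma leq_fact_exp n : n`! <= n ^ n.
Proof.
elim: n => // n IH; rewrite factS expnS leq_mul2l /=.
exact: leq_trans IH (leq_exp_base n (leqnSn n)).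
Qed.

(** For the case [n < k] of the lower bound. [k ^ n] is at most a falling factorial of [k + n],
    hence at most [2 ^ (k + n) * n ^ n], and [2 <= n] turns everything into powers of [n]. *)
Lemma leq_exp_swap d n k : 2 <= n -> n <= k -> k ^ n * n`! ^ d <= n ^ (d.+3 * k).
Proof.
move=> n2 nk; have n0 : 0 < n by exact: ltnW.
have kn : k ^ n <= n ^ (3 * k).
  apply: leq_trans (leq_exp_ffact k n) _; rewrite -bin_ffact.
  apply: leq_trans (leq_mul (leq_bin_exp2 _ _) (leq_fact_exp n)) _.
  apply: (@leq_trans (n ^ (k + n) * n ^ n)); first by rewrite leq_mul // leq_exp_base.
  by rewrite -expnD leq_pexp2l //; move: nk; clear; lia.
apply: leq_trans (leq_mul kn (leq_exp_base d (leq_fact_exp n))) _.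
rewrite -expnM -expnD leq_pexp2l //.
by rewrite -[d.+3]addn3 mulnDl addnC leq_add2r mulnC leq_mul2l nk orbT.
Qed.

(** * Real exponents *)

From mathcomp Require Import all_classical all_reals all_analysis.
Import Order.TTheory GRing.Theory Num.Theory.
Local Open Scope ring_scope.

Lemma powR_natX (R : realType) (x a : R) (p q : nat) : 0 <= x ->
  a * p%:R = q%:R -> (x `^ a) ^+ p = x ^+ q.
Proof.
move=> x0 e; rewrite -powR_mulrn ?powR_ge0 // -powRrM e powR_mulrn //.
Qed.

Lemma card_avoiders0 e k (P : binmx (cube e.+1 k)) : (#|avoiders P 0| <= 1)%N.
Proof.
apply/card_le1_eqP => A B _ _; apply/ffunP=> x.
by have := ltn_ord (x ord0).
Qed.

Lemma rate_exponent (R : realType) e :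
  ((e.+2%:R : R) - 1 - 1 / (e.+2%:R - 1)) * e.+1%:R = (e.+2 * e)%:R.
Proof.
have -> : e.+2%:R - 1 = e.+1%:R :> R by rewrite -[e.+2%:R]natr1 addrK.
have e0 : e.+1%:R != 0 :> R by rewrite pnatr_eq0.
rewrite mulrBl mul1r mulVf // -natrM.
by rewrite (_ : e.+1 * e.+1 = e.+2 * e + 1)%N ?natrD ?addrK //; lia.
Qed.

Lemma avoiders_upper (R : realType) e c :
    (forall k (P : binmx (cube e.+2 k)) n, (0 < k)%N -> (0 < n)%N ->
       permutation_matrix P ->
       (#|avoiders P n| ^ e.+1 <= 2 ^ (c * k * n) * n`! ^ (e.+2 * e))%N) ->
  forall k (P : binmx (cube e.+2 k)) n, (2 <= k)%N -> permutation_matrix P ->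
    (#|avoiders P n|)%:R <= (2 `^ (c.+1%:R * k%:R)) ^+ n *
      (n`!)%:R `^ (e.+2%:R - 1 - 1 / (e.+2%:R - 1)) :> R.
Proof.
move=> Hc k P [_ _|n k2 Pp].
  by rewrite expr0 mul1r fact0 powR1 -[1]/(1%:R) ler_nat card_avoiders0.
set a := _ - 1 / _; set N := n.+1.
rewrite -natrM powR_mulrn ?ler0n // -exprM.
rewrite -(@ler_pXn2r R e.+1) ?nnegrE ?ler0n ?mulr_ge0 ?exprn_ge0 ?powR_ge0 //.
rewrite exprMn (powR_natX (ler0n _ _) (rate_exponent R e)).
rewrite -!natrX -natrM ler_nat.
apply: leq_trans (Hc k P N (ltnW k2) isT Pp) _.
rewrite leq_mul2r -expnM leq_exp2l //; apply/orP; right.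
by rewrite -mulnA mulSn; nia.
Qed.

Lemma avoiders_lower (R : realType) e c : (0 < c)%N ->
    (forall k (P : binmx (cube e.+2 k)) n, (2 <= k)%N -> (k <= n)%N ->
       permutation_matrix P ->
       exists2 l, (k <= (2 * l) ^ (2 ^ e.+1))%N &
         (n`! ^ (e.+2 * e) * l ^ n <= c ^ n * #|avoiders P n| ^ e.+1)%N) ->
  forall k (P : binmx (cube e.+2 k)) n, (2 <= k)%N -> permutation_matrix P ->
    (2 <= n)%N ->
    n%:R `^ (- (e.+2.+3%:R * k%:R)) *
      ((2 * c%:R)^-1 * k%:R `^ (1 / (2 ^+ e.+1 * (e.+2%:R - 1)))) ^+ n *
      (n`!)%:R `^ (e.+2%:R - 1 - 1 / (e.+2%:R - 1))
    <= (#|avoiders P n|)%:R :> R.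
Proof.
move=> c0 Hc k P n k2 Pp n2.
have eE : e.+2%:R - 1 = e.+1%:R :> R by rewrite -[e.+2%:R]natr1 addrK.
have rate := rate_exponent R e.
set a := _ - 1 / _ in rate *; set dl := 1 / _.
have n1 : 1 <= n%:R :> R by rewrite ler1n ltnW.
have k1 : 1 <= k%:R :> R by rewrite ler1n ltnW.
have f1 : 1 <= n`!%:R :> R by rewrite ler1n fact_gt0.
have cR : 1 <= c%:R :> R by rewrite ler1n.
have p2 : 1 <= 2 ^+ e.+1 :> R by rewrite exprn_ege1 // ler1n.
have dl0 : 0 <= dl by rewrite /dl eE divr_ge0 // mulr_ge0 ?ler0n // exprn_ge0.
have dl1 : dl <= 1.
  rewrite /dl eE ler_pdivrMr ?mul1r ?mulr_gt0 ?exprn_gt0 ?ltr0n //.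
  by rewrite mulr_ege1 // ler1n.
have pos : 0 <= (2 * c%:R)^-1 * k%:R `^ dl.
  by rewrite mulr_ge0 ?invr_ge0 ?mulr_ge0 ?powR_ge0.
rewrite powRN -natrM powR_mulrn ?ler0n //.
(* For [n < k] the negative power of [n] brings the left side down to at most 1. *)
have [nk|kn] := ltnP n k.
  apply: (@le_trans _ _ 1); last by rewrite ler1n card_avoiders_small.
  rewrite -mulrA mulrC ler_pdivrMr ?exprn_gt0 ?ltr0n ?(ltnW n2) // mul1r.
  apply: (@le_trans _ _ (k%:R ^+ n * n`!%:R ^+ e.+2)).
    apply: ler_pM; rewrite ?exprn_ge0 ?powR_ge0 //.
      apply: lerXn2r; rewrite ?nnegrE ?ler0n //.
      apply: (@le_trans _ _ (1 * k%:R)); last by rewrite mul1r.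
      apply: ler_pM; rewrite ?invr_ge0 ?mulr_ge0 ?powR_ge0 //.
        by rewrite invf_le1; nra.
      by rewrite -[leRHS]powRr1 ?ler0n // ler_powR.
    rewrite -powR_mulrn ?ler0n // ler_powR //.
    apply: (@le_trans _ _ e.+1%:R); last by rewrite ler_nat.
    by rewrite /a eE gerBl divr_ge0.
  by rewrite -!natrX -natrM ler_nat leq_exp_swap // ltnW.
have [l kl low] := Hc k P n k2 kn Pp.
apply: (@le_trans _ _ (((2 * c%:R)^-1 * k%:R `^ dl) ^+ n * n`!%:R `^ a)).
  rewrite -mulrA ler_piMl ?mulr_ge0 ?exprn_ge0 ?powR_ge0 //.
  by rewrite invf_le1 ?exprn_ege1 // exprn_gt0 // ltr0n ltnW.
rewrite -(@ler_pXn2r R e.+1) ?nnegrE ?ler0n ?mulr_ge0 ?exprn_ge0 ?powR_ge0 //.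
rewrite exprMn (powR_natX (ler0n _ _) rate) exprAC exprMn.
(* The left side is the [2 ^ e.+1]-th root of [k]. *)
have kdl : (k%:R `^ dl) ^+ e.+1 <= (2 * l)%:R :> R.
  rewrite -(@ler_pXn2r R (2 ^ e.+1)) ?expn_gt0 ?nnegrE ?ler0n ?exprn_ge0 ?powR_ge0 //.
  rewrite -exprM (@powR_natX R _ _ _ 1) ?ler0n // ?expr1.
    by rewrite -natrX ler_nat.
  by rewrite /dl eE natrM natrX div1r [X in _ * X]mulrC mulVf //.
have cle : (2 * c%:R)^-1 ^+ e.+1 <= (2 * c%:R)^-1 :> R.
  have i0 : 0 <= (2 * c%:R)^-1 :> R by rewrite invr_ge0 mulr_ge0.
  have i1 : (2 * c%:R)^-1 <= 1 :> R by rewrite invf_le1; nra.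
  by rewrite exprS ler_piMr // exprn_ile1.
have base : (2 * c%:R)^-1 ^+ e.+1 * (k%:R `^ dl) ^+ e.+1 <= l%:R / c%:R :> R.
  apply: (@le_trans _ _ ((2 * c%:R)^-1 * (2 * l)%:R)).
    by apply: ler_pM; rewrite ?exprn_ge0 ?invr_ge0 ?mulr_ge0 ?powR_ge0.
  rewrite natrM le_eqVlt; apply/orP; left; apply/eqP; field.
  by rewrite gt_eqF ?ltr0n.
apply: (@le_trans _ _ ((l%:R / c%:R) ^+ n * n`!%:R ^+ (e.+2 * e))).
  by rewrite ler_wpM2r ?exprn_ge0 //; apply: lerXn2r; rewrite ?nnegrE.
rewrite exprMn exprVn mulrAC ler_pdivrMr ?exprn_gt0 ?ltr0n //.
by rewrite mulrC [leRHS]mulrC -!natrX -!natrM ler_nat.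
Qed.

(* The lower bound fails for n = 1: there #|avoiders P 1| = 1, whereas
   1 `^ (- (C1 * k)) * (c * k `^ e) is unbounded in k.  Hence 2 <= n. *)
Theorem theorem1p8 (R : realType) (d : nat) (hd : (2 <= d)%N) :
  exists C1 C2 c : R,
    [/\ 0 < C1, 0 < C2, 0 < c &
    forall (k : nat) (P : binmx (cube d k)) (n : nat),
      (2 <= k)%N -> permutation_matrix P ->
      ((2 <= n)%N ->
       n%:R `^ (- (C1 * k%:R)) *
         (c * k%:R `^ (1 / (2 ^+ (d - 1)%N * (d%:R - 1)))) ^+ n *
         (n`!)%:R `^ (d%:R - 1 - 1 / (d%:R - 1))
         <= (#|avoiders P n|)%:R) /\
      (#|avoiders P n|)%:R <=
        (2 `^ (C2 * k%:R)) ^+ n *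
        (n`!)%:R `^ (d%:R - 1 - 1 / (d%:R - 1))].
Proof.
case: d hd => [|[|e]] // _.
have [cu Hu] := avoiders_upper_nat e.
have [cl cl0 Hl] := avoiders_lower_nat e.
(* [C1 = d + 3] comes from [leq_exp_swap]; the successor makes [C2] positive; in [c], the 2 pays for
   replacing the root of [k] by [l]. *)
exists e.+2.+3%:R, cu.+1%:R, (2 * cl%:R)^-1.
split; rewrite ?ltr0n ?invr_gt0 ?mulr_gt0 ?ltr0n // => k P n k2 Pp; split.
  by move=> n2; rewrite subn1; exact: (avoiders_lower R cl0 Hl).
exact: (avoiders_upper R Hu).
Qed.
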